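(* Let $\varphi\in L^1(\mathbb{R})\cap L^\infty(\mathbb{R})$ with $\|\varphi\|_{L^\infty(\mathbb{R})}<1/C_{GK}$, and assume in addition that $K\in L^1(\mathbb{R},1+x^2)$. Let $u$ be the global solution of $$u_t(t,x)=\int_{\mathbb{R}}K(x-y)\big(u(t,y)-u(t,x)\big)\,dy+\int_{\mathbb{R}}G(x-y)\Big(\frac{u(t,y)+u(t,x)}{2}\Big)^2dy,\qquad u(0)=\varphi.$$ Then there is a constant $C=C(\|\varphi\|_{L^1(\mathbb{R})},\|\varphi\|_{L^\infty(\mathbb{R})})$ such that $$\|u(t)\|_{L^2(\mathbb{R})}\le C\,t^{-\frac14},\qquad \forall\, t>0.$$ Moreover, if $\|\varphi\|_{L^\infty(\mathbb{R})}<1/(2C_{GK})$, then for any $2\le p<\infty$ there is a constant $C=C(\|\varphi\|_{L^1(\mathbb{R})},\|\varphi\|_{L^\infty(\mathbb{R})})$ such that $$\|u(t)\|_{L^p(\mathbb{R})}\le C\,t^{-\frac12\left(1-\frac1p\right)},\qquad \forall\, t>0.$$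
   Context: Functions are real-valued. The kernels $K,G\in L^1(\mathbb{R})$ satisfy: $K$ is nonnegative and even with $\int_{\mathbb{R}}K(x)\,dx=1$; $G$ is odd; and there is a constant $C_{GK}>0$ with $|G(x)|\le C_{GK}K(x)$ for all $x\in\mathbb{R}$. The notation $K\in L^1(\mathbb{R},1+x^2)$ means $\int_{\mathbb{R}}|K(x)|(1+x^2)\,dx<\infty$. The equation is understood as an ordinary differential equation in $L^1(\mathbb{R})\cap L^\infty(\mathbb{R})$; for $\|\varphi\|_{L^\infty(\mathbb{R})}<1/C_{GK}$ it has a unique global solution $u\in C([0,\infty),L^1(\mathbb{R})\cap L^\infty(\mathbb{R}))$, with $\|u(t)\|_{L^1}\le\|\varphi\|_{L^1}$ and $\|u(t)\|_{L^\infty}\le\|\varphi\|_{L^\infty}$. The kernels $K,G$ (and hence $C_{GK}$) are fixed, so constants may also depend on them and on $p$; the constants do not depend on $t$, and depend on $\varphi$ only through the two indicated norms. *)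

(* Defs.v *)
From HB Require Import structures.
From mathcomp Require Import all_boot all_order all_algebra.
From mathcomp Require Import all_classical all_reals all_analysis.

Set Implicit Arguments.
Unset Strict Implicit.
Unset Printing Implicit Defensive.

Import Order.TTheory GRing.Theory Num.Theory.
Import numFieldNormedType.Exports.

Local Open Scope classical_set_scope.
Local Open Scope ring_scope.

Section Defs.
Context {R : realType}.
Implicit Types (K G f v phi : R -> R) (u : R -> R -> R).

Definition LpNorm (p : \bar R) f : \bar R :=
  Lnorm (@lebesgue_measure R) p (EFin \o f).

(* Functions are handled through representatives: elements of L^1 and L^oo are
   genuine measurable functions, and equality in these spaces is a.e. equality. *)
Definition in_L1Loo f : Prop :=
  f \in Lfun (@lebesgue_measure R) 1%E /\ f \in Lfun (@lebesgue_measure R) +oo%E.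

Definition L1Loo_norm f : \bar R := (LpNorm 1 f + LpNorm +oo f)%E.

Record admissible_kernels K G (CGK : R) : Prop := AdmissibleKernels {
  kernelK_L1 : K \in Lfun (@lebesgue_measure R) 1%E ;
  kernelG_L1 : G \in Lfun (@lebesgue_measure R) 1%E ;
  kernelK_ge0 : forall x, 0 <= K x ;
  kernelK_even : forall x, K (- x) = K x ;
  kernelK_mass : \int[lebesgue_measure]_x K x = 1 ;
  kernelG_odd : forall x, G (- x) = - G x ;
  kernel_const_gt0 : 0 < CGK ;
  kernelG_le : forall x, `|G x| <= CGK * K x }.

(* For v in L^1 and L^oo both integrands are integrable in y for every x. *)
Definition nonlocal_rhs K G v (x : R) : R :=
  \int[lebesgue_measure]_y (K (x - y) * (v y - v x)) +
  \int[lebesgue_measure]_y (G (x - y) * ((v y + v x) / 2) ^+ 2).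

(* u t x is the value at time t and position x; negative times are irrelevant.
   The time derivative is the limit of difference quotients in the norm of the
   intersection of L^1 and L^oo. *)
Record global_solution K G phi u : Prop := GlobalSolution {
  solution_L1Loo : forall t : R, 0 <= t -> in_L1Loo (u t) ;
  solution_continuous : forall t : R, 0 <= t ->
    L1Loo_norm (fun x => u s x - u t x) @[s --> within [set s : R | 0 <= s] (nbhs t)]
      --> (0 : \bar R) ;
  solution_equation : forall t : R, 0 < t ->
    L1Loo_norm (fun x => (u (t + h) x - u t x) / h - nonlocal_rhs K G (u t) x)
      @[h --> 0^'] --> (0 : \bar R) ;
  solution_initial : {ae @lebesgue_measure R, forall x, u 0 x = phi x} }.

End Defs.

(* Main.v *)
Require Import Defs.
From HB Require Import structures.
From mathcomp Require Import all_boot all_order all_algebra.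
From mathcomp Require Import all_classical all_reals all_analysis.
From mathcomp Require Import measurable_realfun ess_sup_inf.
From mathcomp Require Import ring lra.
Import Order.TTheory GRing.Theory Num.Theory.
Import numFieldNormedType.Exports.
Local Open Scope classical_set_scope.
Local Open Scope ring_scope.

Set Implicit Arguments.
Unset Strict Implicit.
Unset Printing Implicit Defensive.

(** Why the theorem holds.  Write [F v] for the right-hand side and [C] for the
kernel constant, let [M] be the essential supremum of [|phi|], [C M < 1].

Bounds.  As [|G| <= C K], on functions with values in [[-M, M]] the Euler map
[v |-> v + h F v], [0 <= h <= 1/2], preserves the order; it fixes constants
because [G] has integral zero, and preserves the integral because the flux is
antisymmetric.  Hence it preserves the bound [M] ([euler_step_bounded]) and
contracts L^1 ([euler_step_L1]).  The equation says that [u (t + h)] is the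
Euler step from [u t] up to an error [o(h)] in both norms ([solution_euler]), so
both bounds pass to the solution by comparison with slowly growing barriers
([barrier], [solution_maximum], [solution_L1]).

Energy.  Let [q = 2n] be even, and test the equation with [u^(q-1)].  With
[j s = s^(q-1)] and [P' s = s^2 j' s], symmetrization turns the convection term
into an integral of [G (x - y)] times [(j a - j b) ((a + b) / 2)^2], where
[a = u x] and [b = u y].  Subtracting [P a - P b] does not change that integral,
and the remaining defect is at most [M (a - b) (j a - j b)] ([flux_defect_le]):
convection absorbs no more than the fraction [C M] of the diffusion.  What is
left controls the Dirichlet form
[D(w) = \int \int K (x - y) (w x - w y)^2] of [w = u^n]
([stroock_varadhan], [energy_inequality]).

Nash inequality.  [K] is bounded below on a compact set of positive measure, so
by Steinhaus' theorem and the triangle inequality [D(w)] controls the L^2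
modulus of [w] under all small translations; [k] successive translations
cost a factor [k^2].  Comparing [w x] with [w (x + z)], averaged over [z] in an
interval of length proportional to [k], gives
[||w||_2^2 <= A (k^2 D(w) + ||w||_1^2 / k)] for every [k >= 1]
([nash_inequality]).

Decay.  Let [y] be the integral of [u^q].  The L^1 norm of [u^n] is bounded by
interpolation between the L^1 bound and [y].  Nash's inequality at the best
scale then shows that [y] decreases faster than a multiple of
[(T0 + t)^(-(q-1)/2)] at any time when the two coincide, for a suitable [T0];
so [y] stays below it ([power_mass_decay]).  Finally
[|u|^p <= l^(p-1) |u| + l^(p-q) |u|^q] with [l = t^(-1/2)] interpolates every
[1 <= p <= q] ([LpNorm_decay]). *)

(** * Invariance of the Lebesgue integral under translation and reflection *)

Section lebesgue_invariance.
Context {R : realType}.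
Local Notation mu := (@lebesgue_measure R).
Local Open Scope ereal_scope.

Lemma lebesgue_measure_shift (c : R) (A : set R) : measurable A ->
  pushforward mu ((fun x => x + c)%R : R -> measurableTypeR R) A = mu A.
Proof.
move=> mA.
have mf : measurable_fun setT ((fun x => x + c)%R : R -> measurableTypeR R).
  exact: measurable_funD.
apply/esym/(lebesgue_measure_unique (mu := pushforward mu _)) => //= _ [[a b]] _ <-.
rewrite /pushforward.
have -> : (fun x : R => (x + c)%R) @^-1` `]a, b]%classic = `](a - c)%R, (b - c)%R]%classic.
  by apply/seteqP; split => x /=; rewrite !in_itv/= ltrBlDr lerBrDr.
rewrite /= !lebesgue_measure_itv/= !lte_fin ltrD2r.
by case: ifP => // _; rewrite -!EFinD; congr EFin; ring.
Qed.

Lemma ge0_integral_shift (f : R -> \bar R) (c : R) : measurable_fun setT f ->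
  (forall x, 0 <= f x) -> \int[mu]_x f (x + c)%R = \int[mu]_x f x.
Proof.
move=> mf f0.
have ms : measurable_fun setT ((fun x => x + c)%R : R -> measurableTypeR R).
  exact: measurable_funD.
transitivity (\int[pushforward mu ((fun x => x + c)%R : R -> measurableTypeR R)]_x f x).
  by rewrite ge0_integral_pushforward.
by apply: eq_measure_integral => //= A mA _; exact: lebesgue_measure_shift.
Qed.

Lemma ge0_integral_opp (f : R -> \bar R) : measurable_fun setT f ->
  (forall x, 0 <= f x) -> \int[mu]_x f (- x)%R = \int[mu]_x f x.
Proof.
move=> mf f0.
transitivity (\int[pushforward mu (-%R : R -> measurableTypeR R)]_x f x).
  by rewrite ge0_integral_pushforward.
by apply: eq_measure_integral => //= A mA _; exact: lebesgue_measureN.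
Qed.

Lemma ge0_integral_reflect (f : R -> \bar R) (c : R) : measurable_fun setT f ->
  (forall x, 0 <= f x) -> \int[mu]_x f (c - x)%R = \int[mu]_x f x.
Proof.
move=> mf f0; rewrite -(ge0_integral_opp mf)//.
rewrite -(@ge0_integral_shift (fun x => f (- x)%R) (- c))//.
  by apply: eq_integral => x _; rewrite opprD opprK addrC.
exact: measurableT_comp.
Qed.

Lemma integrable_reflect (f : R -> \bar R) (c : R) : mu.-integrable setT f ->
  mu.-integrable setT (fun x => f (c - x)%R).
Proof.
move=> /integrableP[mf fy]; apply/integrableP; split.
  by apply: (measurableT_comp mf); exact: measurable_funB.
rewrite (@ge0_integral_reflect (fun x => `|f x|))//.
exact: measurableT_comp.
Qed.

Lemma integrable_shift (f : R -> \bar R) (c : R) : mu.-integrable setT f ->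
  mu.-integrable setT (fun x => f (x - c)%R).
Proof.
move=> /integrableP[mf fy]; apply/integrableP; split.
  by apply: (measurableT_comp mf); exact: measurable_funB.
rewrite (@ge0_integral_shift (fun x => `|f x|) (- c)%R)//.
exact: measurableT_comp.
Qed.

Lemma integral_reflect (f : R -> \bar R) (c : R) : measurable_fun setT f ->
  \int[mu]_x f (c - x)%R = \int[mu]_x f x.
Proof.
move=> mf; rewrite integralE [RHS]integralE; congr (_ - _).
  transitivity (\int[mu]_x f^\+ (c - x)%R).
    by apply: eq_integral => x _; rewrite ?funeposE ?funenegE.
  by apply: ge0_integral_reflect; [exact: measurable_funepos|move=> x; exact: funepos_ge0].
transitivity (\int[mu]_x f^\- (c - x)%R).
    by apply: eq_integral => x _; rewrite ?funeposE ?funenegE.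
by apply: ge0_integral_reflect; [exact: measurable_funeneg|move=> x; exact: funeneg_ge0].
Qed.

End lebesgue_invariance.

(** * Integrable real functions and double integrals *)

Section integrable_real.
Context {R : realType}.
Local Notation mu := (@lebesgue_measure R).
Local Notation intg f := (mu.-integrable setT (EFin \o f)).
Implicit Types f g : R -> R.

Lemma intg_measurable f : intg f -> measurable_fun setT f.
Proof. by move=> /measurable_int /measurable_EFinP. Qed.

Lemma intg_dominated f g : measurable_fun setT f ->
  (forall x, `|f x| <= g x) -> intg g -> intg f.
Proof.
move=> mf fg ig; apply: le_integrable ig => //; first exact/measurable_EFinP.
by move=> x _ /=; rewrite lee_fin (le_trans (fg x))// ler_norm.
Qed.

Lemma intgD f g : intg f -> intg g -> intg (fun x => f x + g x).
Proof. by move=> fi gi; have := integrableD measurableT fi gi. Qed.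

Lemma intgB f g : intg f -> intg g -> intg (fun x => f x - g x).
Proof. by move=> fi gi; have := integrableB measurableT fi gi. Qed.

Lemma intgZl c f : intg f -> intg (fun x => c * f x).
Proof. by move=> fi; have := integrableZl measurableT c fi. Qed.

Lemma intg_norm f : intg f -> intg (fun x => `|f x|).
Proof. by move=> fi; have := integrable_abse fi. Qed.

Lemma intg_bounded f g (M : R) : intg f -> measurable_fun setT g ->
  (forall x, `|g x| <= M) -> intg (fun x => f x * g x).
Proof.
move=> fi mg gM; apply: (@intg_dominated _ (fun x => M * `|f x|)).
- by apply: measurable_funM => //; exact: intg_measurable.
- by move=> x; rewrite normrM mulrC ler_wpM2r.
- exact/intgZl/intg_norm.
Qed.

Lemma intg_pow f (M : R) n : intg f -> (forall x, `|f x| <= M) ->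
  intg (fun x => f x ^+ n.+1).
Proof.
move=> fi fM.
have -> : (fun x => f x ^+ n.+1) = (fun x => f x * f x ^+ n).
  by apply/funext => x; rewrite exprS.
apply: (@intg_bounded _ _ (M ^+ n)) => //.
  by apply: measurable_funX; exact: intg_measurable.
by move=> x; rewrite normrX lerXn2r// ?nnegrE// (le_trans _ (fM x)).
Qed.

Lemma intg_fineK f : intg f -> (\int[mu]_x f x)%:E = (\int[mu]_x (f x)%:E)%E.
Proof. by move=> fi; rewrite /Rintegral fineK//; exact: integrable_fin_num. Qed.

Lemma ae_imply (P Q : R -> Prop) : (forall x, P x -> Q x) ->
  {ae mu, forall x, P x} -> {ae mu, forall x, Q x}.
Proof.
move=> PQ; apply: (@filterS R _ (ae_filter_ringOfSetsType mu)).
exact: PQ.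
Qed.

Lemma ae_imply2 (P P' Q : R -> Prop) : (forall x, P x -> P' x -> Q x) ->
  {ae mu, forall x, P x} -> {ae mu, forall x, P' x} -> {ae mu, forall x, Q x}.
Proof.
move=> PQ; apply: (@filterS2 R _ (ae_filter_ringOfSetsType mu)).
exact: PQ.
Qed.

Lemma tonelli_swap (F : R -> R -> \bar R) :
  measurable_fun setT (fun p : R * R => F p.1 p.2) ->
  (forall x y, 0 <= F x y)%E ->
  (\int[mu]_x \int[mu]_y F x y = \int[mu]_y \int[mu]_x F x y)%E.
Proof.
move=> mF F0.
exact: (fubini_tonelli (m1 := mu) (m2 := mu) (fun p : R * R => F p.1 p.2) mF).
Qed.

Lemma measurable_tonelli (F : R -> R -> \bar R) :
  measurable_fun setT (fun p : R * R => F p.1 p.2) ->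
  (forall x y, 0 <= F x y)%E ->
  measurable_fun setT (fun x => \int[mu]_y F x y)%E.
Proof.
move=> mF F0.
exact: (measurable_fun_fubini_tonelli_F (m2 := mu) (fun p : R * R => F p.1 p.2) mF).
Qed.

Lemma Rintegral0 : \int[mu]_x (0 : R) = 0.
Proof. by rewrite /Rintegral integral0. Qed.

Lemma ae_eq_Rintegral f g : measurable_fun setT f -> measurable_fun setT g ->
  {ae mu, forall x, f x = g x} -> \int[mu]_x f x = \int[mu]_x g x.
Proof.
move=> mf mg fg; rewrite /Rintegral; congr fine.
apply: ae_eq_integral => //; try exact/measurable_EFinP.
by apply: ae_imply fg => x /= -> _.
Qed.

Lemma ae_le_Rintegral f g : intg f -> intg g ->
  {ae mu, forall x, f x <= g x} -> \int[mu]_x f x <= \int[mu]_x g x.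
Proof.
move=> fi gi fg.
have mf := intg_measurable fi; have mg := intg_measurable gi.
rewrite (@ae_eq_Rintegral f (fun x => Num.min (f x) (g x)))//.
- apply: le_Rintegral => //.
    apply: (@intg_dominated _ (fun x => `|f x| + `|g x|)).
    + exact: measurable_minr.
    + move=> x; rewrite /Num.min; case: ifP => _; first by rewrite lerDl.
      by rewrite lerDr.
    + by apply: intgD; exact: intg_norm.
  by move=> x _; rewrite ge_min lexx orbT.
- exact: measurable_minr.
- by apply: ae_imply fg => x h; rewrite min_l.
Qed.

End integrable_real.

(** Domination by [k (x - y) (|f x| + |f y|)] covers the flux, the Dirichlet
integrand and their products with bounded functions, and for even [k]
it is stable under exchange of [x] and [y]; it is the only form in which Fubini's theorem is used
for signed integrands. *)
Section double_integral.
Context {R : realType}.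
Local Notation mu := (@lebesgue_measure R).
Local Notation intg f := (mu.-integrable setT (EFin \o f)).
Context {k f : R -> R} {B : R}.
Hypothesis k0 : forall x, 0 <= k x.
Hypothesis ki : intg k.
Hypothesis fi : intg f.
Hypothesis fB : forall x, `|f x| <= B.

Lemma measurable_conv_kernel (g : R -> R) : measurable_fun setT g ->
  measurable_fun setT (fun p : R * R => g (p.1 - p.2)).
Proof.
move=> mg; apply: (measurableT_comp mg).
by apply: measurable_funB; [exact: measurable_fst|exact: measurable_snd].
Qed.

Lemma tonelli_conv_kernel :
  (\int[mu]_x \int[mu]_y (k (x - y) * (`|f x| + `|f y|))%:E < +oo)%E.
Proof.
have mk := intg_measurable ki; have mf := intg_measurable fi.
have mkE := measurable_conv_kernel mk.
have mF1 : measurable_fun setT (fun p : R * R => (k (p.1 - p.2) * `|f p.1|)%:E).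
  apply/measurable_EFinP/measurable_funM => //.
  by apply: measurableT_comp => //; apply: measurableT_comp => //; exact: measurable_fst.
have mF2 : measurable_fun setT (fun p : R * R => (k (p.1 - p.2) * `|f p.2|)%:E).
  apply/measurable_EFinP/measurable_funM => //.
  by apply: measurableT_comp => //; apply: measurableT_comp => //; exact: measurable_snd.
have F10 (p : R * R) : (0 <= (k (p.1 - p.2) * `|f p.1|)%:E)%E.
  by rewrite lee_fin mulr_ge0.
have F20 (p : R * R) : (0 <= (k (p.1 - p.2) * `|f p.2|)%:E)%E.
  by rewrite lee_fin mulr_ge0.
have kf : (\int[mu]_x (`|f x|)%:E * \int[mu]_y (k y)%:E < +oo)%E.
  rewrite -(intg_fineK (intg_norm fi)) -(intg_fineK ki).
  by rewrite -EFinM ltry.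
have sl1 (x : R) : measurable_fun setT (fun y : R => (k (x - y) * `|f x|)%:E).
  apply/measurable_EFinP/measurable_funM => //; apply: (measurableT_comp mk).
  exact: measurable_funB.
have sl2 (x : R) : measurable_fun setT (fun y : R => (k (x - y) * `|f y|)%:E).
  apply/measurable_EFinP/measurable_funM.
    by apply: (measurableT_comp mk); exact: measurable_funB.
  exact: measurableT_comp.
have int1 : (\int[mu]_x \int[mu]_y (k (x - y) * `|f x|)%:E =
             \int[mu]_x (`|f x|)%:E * \int[mu]_y (k y)%:E)%E.
  rewrite -ge0_integralZr//; last 2 first.
  - by apply/measurable_EFinP; exact: measurableT_comp.
  - by apply: integral_ge0 => x _; rewrite lee_fin.
  apply: eq_integral => x _.
  rewrite -(@ge0_integral_reflect _ (fun y : R => (k y)%:E) x)//; last first.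
    exact/measurable_EFinP.
  rewrite muleC -ge0_integralZr//.
    by apply/measurable_EFinP/(measurableT_comp mk); exact: measurable_funB.
  by move=> y _; rewrite lee_fin.
have int2 : (\int[mu]_x \int[mu]_y (k (x - y) * `|f y|)%:E =
             \int[mu]_x (`|f x|)%:E * \int[mu]_y (k y)%:E)%E.
  rewrite (tonelli_swap mF2); last by move=> x y; exact: (F20 (x, y)).
  rewrite -ge0_integralZr//; last 2 first.
  - by apply/measurable_EFinP; exact: measurableT_comp.
  - by apply: integral_ge0 => x _; rewrite lee_fin.
  apply: eq_integral => y _.
  rewrite -(@ge0_integral_shift _ (fun y : R => (k y)%:E) (- y))//; last first.
    exact/measurable_EFinP.
  rewrite muleC -ge0_integralZr//.
    by apply/measurable_EFinP/(measurableT_comp mk); exact: measurable_funB.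
  by move=> x _; rewrite lee_fin.
have -> : (\int[mu]_x \int[mu]_y (k (x - y) * (`|f x| + `|f y|))%:E =
  \int[mu]_x (\int[mu]_y (k (x - y) * `|f x|)%:E + \int[mu]_y (k (x - y) * `|f y|)%:E))%E.
  apply: eq_integral => x _.
  have := @ge0_integralD _ _ _ mu setT measurableT _ _
    (fun y _ => F10 (x, y)) (sl1 x) (fun y _ => F20 (x, y)) (sl2 x).
  move=> /= <-; apply: eq_integral => y _; by rewrite -EFinD mulrDr.
rewrite ge0_integralD//; last 4 first.
- by move=> x _; apply: integral_ge0 => y _; rewrite lee_fin mulr_ge0.
- by apply: (measurable_tonelli mF1) => x y; exact: (F10 (x, y)).
- by move=> x _; apply: integral_ge0 => y _; rewrite lee_fin mulr_ge0.
- by apply: (measurable_tonelli mF2) => x y; exact: (F20 (x, y)).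
by rewrite int1 int2 lte_add_pinfty.
Qed.

Context {H : R -> R -> R}.
Hypothesis mH : measurable_fun setT (fun p : R * R => H p.1 p.2).
Hypothesis Hle : forall x y, `|H x y| <= k (x - y) * (`|f x| + `|f y|).

Lemma intg_slice1 x : intg (H x).
Proof.
apply: (@intg_dominated _ _ (fun y : R => (B + B) * k (x - y))).
- exact: (measurableT_comp mH (pair1_measurable x)).
- move=> y; apply: le_trans (Hle x y) _.
  by rewrite mulrC ler_wpM2r// lerD.
- by apply/intgZl; apply: (@integrable_reflect _ (EFin \o k)).
Qed.

Lemma intg_slice2 y : intg (H ^~ y).
Proof.
apply: (@intg_dominated _ _ (fun x : R => (B + B) * k (x - y))).
- exact: (measurableT_comp mH (pair2_measurable y)).
- move=> x; apply: le_trans (Hle x y) _.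
  by rewrite mulrC ler_wpM2r// lerD.
- by apply/intgZl; apply: (@integrable_shift _ (EFin \o k)).
Qed.

Lemma intg_product : (mu \x mu)%E.-integrable setT (fun p : R * R => (H p.1 p.2)%:E).
Proof.
apply/integrable12ltyP; first exact/measurable_EFinP.
apply: le_lt_trans tonelli_conv_kernel.
have mG : measurable_fun setT
    (fun p : R * R => (k (p.1 - p.2) * (`|f p.1| + `|f p.2|))%:E).
  apply/measurable_EFinP/measurable_funM.
    exact: measurable_conv_kernel (intg_measurable ki).
  apply: measurable_funD; apply: measurableT_comp => //;
    apply: (measurableT_comp (intg_measurable fi)).
    exact: measurable_fst.
  exact: measurable_snd.
have mHn : measurable_fun setT (fun p : R * R => `|(H p.1 p.2)%:E|%E).
  by apply: measurableT_comp => //; exact/measurable_EFinP.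
apply: ge0_le_integral => //.
- by move=> x _; exact: integral_ge0.
- exact: (measurable_tonelli mHn).
- apply: (measurable_tonelli mG) => x y.
  by rewrite lee_fin mulr_ge0// addr_ge0.
move=> x _; apply: ge0_le_integral => //.
- exact: (measurableT_comp mHn (pair1_measurable x)).
- exact: (measurableT_comp mG (pair1_measurable x)).
- by move=> y _ /=; rewrite lee_fin Hle.
Qed.

Lemma intg_inner : intg (fun x => \int[mu]_y H x y).
Proof.
have := integrable_fubini_F intg_product.
congr (mu.-integrable setT _); apply/funext => x /=.
by rewrite intg_fineK//; exact: intg_slice1.
Qed.

Lemma Rintegral_swap :
  \int[mu]_x \int[mu]_y H x y = \int[mu]_y \int[mu]_x H x y.
Proof.
rewrite /Rintegral; congr fine.
transitivity (\int[mu]_x \int[mu]_y (H x y)%:E)%E.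
  by apply: eq_integral => x _; rewrite -intg_fineK//; exact: intg_slice1.
have /= -> := Fubini intg_product.
by apply: eq_integral => y _; rewrite -intg_fineK//; exact: intg_slice2.
Qed.

End double_integral.

(** * The nonlocal operator and its Euler step *)

Section nonlocal_operator.
Context {R : realType} {K G : R -> R} {C : R}.
Hypothesis hKG : admissible_kernels K G C.
Local Notation mu := (@lebesgue_measure R).
Local Notation intg f := (mu.-integrable setT (EFin \o f)).

Lemma kernelK_intg : intg K.
Proof. exact/Lfun1_integrable/(kernelK_L1 hKG). Qed.

Lemma kernelG_intg : intg G.
Proof. exact/Lfun1_integrable/(kernelG_L1 hKG). Qed.

Lemma kernelK_slice x : intg (fun y => K (x - y)).
Proof. exact: (@integrable_reflect _ (EFin \o K) x kernelK_intg). Qed.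

Lemma kernelG_slice x : intg (fun y => G (x - y)).
Proof. exact: (@integrable_reflect _ (EFin \o G) x kernelG_intg). Qed.

Lemma kernelK_slice_mass x : \int[mu]_y K (x - y) = 1.
Proof.
rewrite -(kernelK_mass hKG) /Rintegral; congr fine.
apply: (@integral_reflect _ (EFin \o K)).
by have /measurable_EFinP := intg_measurable kernelK_intg.
Qed.

Lemma eq_opp_eq0 (a : R) : a = - a -> a = 0.
Proof. by move=> ?; lra. Qed.

Lemma kernelG_slice_mass x : \int[mu]_y G (x - y) = 0.
Proof.
have mG := intg_measurable kernelG_intg.
have GE z : \int[mu]_y G (z - y) = \int[mu]_y G y.
  rewrite /Rintegral; congr fine; apply: (@integral_reflect _ (EFin \o G)).
  exact/measurable_EFinP.
have G0 : \int[mu]_y G y = - \int[mu]_y G y.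
  rewrite -{1}(GE 0) -mulN1r -RintegralZl//; last exact: kernelG_intg.
  by apply: eq_Rintegral => y _; rewrite add0r (kernelG_odd hKG) mulN1r.
by rewrite GE; exact: eq_opp_eq0.
Qed.

Lemma kernel_const_ge0 : 0 <= C.
Proof. exact: ltW (kernel_const_gt0 hKG). Qed.

Definition flux (v : R -> R) (x y : R) : R :=
  K (x - y) * (v y - v x) + G (x - y) * ((v y + v x) / 2) ^+ 2.

Section bounded.
Context {v : R -> R} {M : R}.
Hypothesis mv : measurable_fun setT v.
Hypothesis vM : forall x, `|v x| <= M.

Lemma flux_diffusion_intg x : intg (fun y => K (x - y) * (v y - v x)).
Proof.
apply: (@intg_bounded _ _ _ (M + M)); first exact: kernelK_slice.
  exact: measurable_funB.
by move=> y; rewrite (le_trans (ler_normB _ _))// lerD.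
Qed.

Lemma flux_convection_intg x : intg (fun y => G (x - y) * ((v y + v x) / 2) ^+ 2).
Proof.
apply: (@intg_bounded _ _ _ (M ^+ 2)); first exact: kernelG_slice.
  by apply: measurable_funX; apply: measurable_funM => //; exact: measurable_funD.
move=> y; rewrite normrX lerXn2r ?nnegrE//; first exact: le_trans (vM x).
rewrite normrM [`|2^-1|]gtr0_norm// ler_pdivrMr// mulr_natr mulr2n.
by rewrite (le_trans (ler_normD _ _))// lerD.
Qed.

Lemma flux_intg x : intg (flux v x).
Proof. by apply: intgD; [exact: flux_diffusion_intg|exact: flux_convection_intg]. Qed.

Lemma nonlocal_rhsE x : nonlocal_rhs K G v x = \int[mu]_y flux v x y.
Proof.
rewrite /nonlocal_rhs -RintegralD//.
- exact: flux_diffusion_intg.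
- exact: flux_convection_intg.
Qed.

End bounded.

Lemma nonlocal_rhs_cst (c x : R) : nonlocal_rhs K G (fun=> c) x = 0.
Proof.
rewrite /nonlocal_rhs.
under eq_Rintegral do rewrite subrr mulr0.
rewrite Rintegral0 add0r RintegralZr//; last exact: kernelG_slice.
by rewrite kernelG_slice_mass mul0r.
Qed.

(** Up to the compensation [2 k (a' - a)], the flux increases in both values: the
difference of the two sides is [(k + g s) ((b' - b) + (a' - a))], where [s], the
mean of the four values, lies in [[-M, M]], so that [|g s| <= k]. *)
Lemma flux_ge (k g a b a' b' M : R) : 0 <= k -> `|g| <= C * k -> C * M <= 1 ->
  `|a| <= M -> `|b| <= M -> `|a'| <= M -> `|b'| <= M -> a <= a' -> b <= b' ->
  k * (b - a) + g * ((b + a) / 2) ^+ 2 - 2 * k * (a' - a) <=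
  k * (b' - a') + g * ((b' + a') / 2) ^+ 2.
Proof.
move=> k0 gk CM aM bM aM' bM' aa bb.
set s := (a' + b' + a + b) / 4.
have sM : `|s| <= M.
  move: aM bM aM' bM'; rewrite /s !ler_norml => /andP[? ?] /andP[? ?] /andP[? ?] /andP[? ?].
  by apply/andP; split; lra.
have gs : `|g * s| <= k.
  rewrite normrM; apply: le_trans (_ : C * k * M <= _); first exact: ler_pM.
  by rewrite mulrAC ler_piMl.
have d : k * (b' - a') + g * ((b' + a') / 2) ^+ 2 -
   (k * (b - a) + g * ((b + a) / 2) ^+ 2 - 2 * k * (a' - a)) =
   (k + g * s) * ((b' - b) + (a' - a)).
  by rewrite /s; field.
rewrite -subr_ge0 d; apply: mulr_ge0; last by rewrite addr_ge0// subr_ge0.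
by move: gs; rewrite ler_norml => /andP[]; lra.
Qed.

Lemma nonlocal_rhs_quasimonotone (v w : R -> R) (M : R) x :
  measurable_fun setT v -> measurable_fun setT w ->
  (forall x, `|v x| <= M) -> (forall x, `|w x| <= M) -> C * M <= 1 ->
  (forall x, v x <= w x) ->
  nonlocal_rhs K G v x - 2 * (w x - v x) <= nonlocal_rhs K G w x.
Proof.
move=> mv mw vM wM CM vw.
rewrite (nonlocal_rhsE mv vM) (nonlocal_rhsE mw wM).
have -> : 2 * (w x - v x) = \int[mu]_y (2 * (w x - v x) * K (x - y)).
  by rewrite RintegralZl ?kernelK_slice_mass ?mulr1//; exact: kernelK_slice.
rewrite -RintegralB//; last 2 first.
- exact: (flux_intg mv vM).
- exact/intgZl/kernelK_slice.
apply: le_Rintegral => //.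
- apply: intgB; first exact: (flux_intg mv vM).
  exact/intgZl/kernelK_slice.
- exact: (flux_intg mw wM).
- move=> y _; rewrite mulrAC.
  apply: (@flux_ge _ _ _ _ _ _ M) => //; first exact: (kernelK_ge0 hKG).
  exact: (kernelG_le hKG).
Qed.

Lemma euler_step_monotone (v w : R -> R) (M h x : R) :
  measurable_fun setT v -> measurable_fun setT w ->
  (forall x, `|v x| <= M) -> (forall x, `|w x| <= M) -> C * M <= 1 ->
  (forall x, v x <= w x) -> 0 <= h <= 1 / 2 ->
  v x + h * nonlocal_rhs K G v x <= w x + h * nonlocal_rhs K G w x.
Proof.
move=> mv mw vM wM CM vw /andP[h0 h2].
have := nonlocal_rhs_quasimonotone x mv mw vM wM CM vw.
move=> /(ler_wpM2l h0); rewrite mulrBr.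
have : h * (2 * (w x - v x)) <= w x - v x.
  by rewrite mulrA ler_piMl ?subr_ge0//; lra.
lra.
Qed.

(** The step preserves order and fixes the constants [M] and [- M]. *)
Lemma euler_step_bounded (v : R -> R) (M h x : R) :
  measurable_fun setT v -> (forall x, `|v x| <= M) -> C * M <= 1 ->
  0 <= h <= 1 / 2 -> `|v x + h * nonlocal_rhs K G v x| <= M.
Proof.
move=> mv vM CM h2.
have M0 : 0 <= M by exact: le_trans (vM 0).
have cM (y : R) : `|cst M y : R| <= M by rewrite /= ger0_norm.
have cNM (y : R) : `|cst (- M) y : R| <= M by rewrite /= normrN ger0_norm.
have v1 y : v y <= cst M y by rewrite (le_trans (ler_norm _)).
have v2 y : cst (- M) y <= v y.
  by have := vM y; rewrite ler_norml => /andP[].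
have := euler_step_monotone x mv (measurable_cst _) vM cM CM v1 h2.
have := euler_step_monotone x (measurable_cst _) mv cNM vM CM v2 h2.
rewrite /cst !nonlocal_rhs_cst mulr0 !addr0 => a b.
by rewrite ler_norml a b.
Qed.

Lemma flux_le (v : R -> R) (M : R) x y : (forall x, `|v x| <= M) -> C * M <= 1 ->
  `|flux v x y| <= 2 * K (x - y) * (`|v x| + `|v y|).
Proof.
move=> vM CM; have k0 := kernelK_ge0 hKG (x - y); have C0 := kernel_const_ge0.
have gk := kernelG_le hKG (x - y).
set k := K (x - y); set g := G (x - y); set a := v x; set b := v y.
have s0 : 0 <= `|a| + `|b| by rewrite addr_ge0.
rewrite /flux (le_trans (ler_normD _ _))//.
have h1 : `|k * (b - a)| <= k * (`|a| + `|b|).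
  by rewrite normrM ger0_norm// ler_wpM2l// (le_trans (ler_normB _ _))// addrC.
have h2 : `|g * ((b + a) / 2) ^+ 2| <= k * (`|a| + `|b|).
  rewrite normrM; have h3 : `|((b + a) / 2) ^+ 2| <= M * (`|a| + `|b|).
    rewrite normrX expr2 ler_pM//.
      rewrite normrM [`|2^-1|]gtr0_norm// ler_pdivrMr// mulr_natr mulr2n.
      by rewrite (le_trans (ler_normD _ _))// lerD// vM.
    rewrite normrM [`|2^-1|]gtr0_norm// ler_pdivrMr// (le_trans (ler_normD _ _))//.
    by rewrite addrC; lra.
  apply: le_trans (_ : (C * k) * (M * (`|a| + `|b|)) <= _).
    by apply: ler_pM => //; exact: mulr_ge0.
  rewrite mulrACA -[leRHS]mul1r -mulrA mulrA ler_wpM2r//; exact: mulr_ge0.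
by rewrite -/k -/g -/a -/b; lra.
Qed.

Lemma measurable_flux (v : R -> R) : measurable_fun setT v ->
  measurable_fun setT (fun p : R * R => flux v p.1 p.2).
Proof.
move=> mv.
have m1 : measurable_fun setT (fun p : R * R => v p.1).
  by apply: (measurableT_comp mv); exact: measurable_fst.
have m2 : measurable_fun setT (fun p : R * R => v p.2).
  by apply: (measurableT_comp mv); exact: measurable_snd.
apply: measurable_funD; apply: measurable_funM.
- exact: measurable_conv_kernel (intg_measurable kernelK_intg).
- exact: measurable_funB.
- exact: measurable_conv_kernel (intg_measurable kernelG_intg).
- by apply: measurable_funX; apply: measurable_funM => //; exact: measurable_funD.
Qed.

Section integrable_bounded.
Context {v : R -> R} {M : R}.
Hypothesis iv : intg v.
Hypothesis vM : forall x, `|v x| <= M.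
Hypothesis CM : C * M <= 1.

Lemma kernelKZ_ge0 (c : R) : 0 <= c -> forall x, 0 <= c * K x.
Proof. by move=> c0 x; rewrite mulr_ge0//; exact: (kernelK_ge0 hKG). Qed.

Lemma nonlocal_rhs_intg : intg (nonlocal_rhs K G v).
Proof.
have mv := intg_measurable iv.
rewrite (_ : nonlocal_rhs K G v = fun x => \int[mu]_y flux v x y); last first.
  by apply/funext => x; rewrite (nonlocal_rhsE mv vM).
apply: (intg_inner (k := fun x => 2 * K x) (f := v) (B := M)) => //.
- exact: kernelKZ_ge0.
- exact/intgZl/kernelK_intg.
- exact: measurable_flux.
- by move=> x y; exact: flux_le.
Qed.

(** [K] is even and [G] is odd, so exchanging [x] and [y] reverses the flux. *)
Lemma nonlocal_rhs_conservative : \int[mu]_x nonlocal_rhs K G v x = 0.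
Proof.
have mv := intg_measurable iv.
have E : \int[mu]_x nonlocal_rhs K G v x = \int[mu]_x \int[mu]_y flux v x y.
  by apply: eq_Rintegral => x _; rewrite (nonlocal_rhsE mv vM).
have S : \int[mu]_x \int[mu]_y flux v x y = \int[mu]_y \int[mu]_x flux v x y.
  apply: (Rintegral_swap (k := fun x => 2 * K x) (f := v) (B := M)) => //.
  - exact: kernelKZ_ge0.
  - exact/intgZl/kernelK_intg.
  - exact: measurable_flux.
  - by move=> x y; exact: flux_le.
have : \int[mu]_y \int[mu]_x flux v x y = - \int[mu]_x \int[mu]_y flux v x y.
  rewrite -mulN1r -RintegralZl//; last first.
    have := nonlocal_rhs_intg; congr (mu.-integrable setT _).
    by apply/funext => x /=; rewrite (nonlocal_rhsE mv vM).
  apply: eq_Rintegral => y _; rewrite -RintegralZl//; last exact: (flux_intg mv vM).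
  apply: eq_Rintegral => x _; rewrite /flux -(opprB y x).
  rewrite (kernelK_even hKG) (kernelG_odd hKG).
  by ring.
by rewrite -S -E => /eq_opp_eq0.
Qed.

Lemma euler_step_mass (h : R) :
  \int[mu]_x (v x + h * nonlocal_rhs K G v x) = \int[mu]_x v x.
Proof.
rewrite RintegralD//; last exact/intgZl/nonlocal_rhs_intg.
rewrite RintegralZl//; last exact: nonlocal_rhs_intg.
by rewrite nonlocal_rhs_conservative mulr0 addr0.
Qed.

End integrable_bounded.

(** Crandall and Tartar: let [T] be the step, [vp = max v 0] and [vn = min v 0].
Order preservation gives [T vn <= T v <= T vp] and [T vn <= 0 <= T vp], so
[|T v| <= T vp - T vn], whose integral is that of [vp - vn = |v|]. *)
Lemma euler_step_L1 (v : R -> R) (M h : R) :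
  intg v -> (forall x, `|v x| <= M) -> C * M <= 1 -> 0 <= h <= 1 / 2 ->
  \int[mu]_x `|v x + h * nonlocal_rhs K G v x| <= \int[mu]_x `|v x|.
Proof.
move=> iv vM CM hh; have mv := intg_measurable iv.
have M0 : 0 <= M := le_trans (normr_ge0 _) (vM 0).
pose vp x := Num.max (v x) 0; pose vn x := Num.min (v x) 0.
have vpM x : `|vp x| <= M.
  by rewrite /vp /Num.max; case: ifP; rewrite ?normr0.
have vnM x : `|vn x| <= M.
  by rewrite /vn /Num.min; case: ifP; rewrite ?normr0.
have vpv x : `|vp x| <= `|v x| by rewrite /vp /Num.max; case: ifP; rewrite ?normr0.
have vnv x : `|vn x| <= `|v x| by rewrite /vn /Num.min; case: ifP; rewrite ?normr0.
have mp : measurable_fun setT vp by exact: measurable_maxr.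
have mn : measurable_fun setT vn by exact: measurable_minr.
have ivp : intg vp by apply: intg_dominated vpv _ => //; exact: intg_norm.
have ivn : intg vn by apply: intg_dominated vnv _ => //; exact: intg_norm.
have vpn x : `|v x| = vp x - vn x.
  rewrite /vp /vn; have [v0|v0] := lerP 0 (v x); last by rewrite ltr0_norm// sub0r.
  by rewrite ger0_norm// subr0.
pose T w x := w x + h * nonlocal_rhs K G w x.
have iT w : intg w -> (forall x, `|w x| <= M) -> intg (T w).
  by move=> iw wM; apply: intgD => //; exact/intgZl/nonlocal_rhs_intg.
have z0 (y : R) : `|cst 0 y : R| <= M by rewrite /= normr0.
have T0 x : T (cst 0) x = 0 by rewrite /T nonlocal_rhs_cst mulr0 addr0.
have le1 x : T v x <= T vp x.
  by apply: (euler_step_monotone x mv mp vM vpM CM) => // y; rewrite /vp le_max lexx.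
have le2 x : T vn x <= T v x.
  by apply: (euler_step_monotone x mn mv vnM vM CM) => // y; rewrite /vn ge_min lexx.
have le3 x : 0 <= T vp x.
  rewrite -(T0 x); apply: (euler_step_monotone x (measurable_cst _) mp z0 vpM CM) => // y.
  by rewrite /vp le_max lexx orbT.
have le4 x : T vn x <= 0.
  rewrite -(T0 x); apply: (euler_step_monotone x mn (measurable_cst _) vnM z0 CM) => // y.
  by rewrite /vn ge_min lexx orbT.
apply: le_trans (_ : \int[mu]_x (T vp x - T vn x) <= _).
  apply: le_Rintegral => //.
  - exact/intg_norm/iT.
  - by apply: intgB; exact: iT.
  - move=> x _; have := le1 x; have := le2 x; have := le3 x; have := le4 x.
    by rewrite -/(T v x) ler_norml => *; apply/andP; split; lra.
rewrite RintegralB//; try exact: iT.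
rewrite /T (euler_step_mass ivp vpM CM) (euler_step_mass ivn vnM CM).
by rewrite -RintegralB//; under [leRHS]eq_Rintegral do rewrite vpn.
Qed.

End nonlocal_operator.

(** * Scalar inequalities for odd powers *)

Section scalar_inequalities.
Context {R : realType}.
Implicit Types a b M s : R.

Lemma odd_powerN m a : (- a) ^+ m.*2.+1 = - a ^+ m.*2.+1.
Proof. by rewrite exprNn -signr_odd oddS odd_double expr1 mulN1r. Qed.

Lemma odd_power_mono m a b : b <= a -> b ^+ m.*2.+1 <= a ^+ m.*2.+1.
Proof.
move=> ba; have [b0|b0] := lerP 0 b; first by rewrite lerXn2r// nnegrE// (le_trans b0).
have [a0|a0] := lerP 0 a.
  apply: le_trans (_ : 0 <= _); last exact: exprn_ge0.
  by rewrite exprS mulr_le0_ge0 ?(ltW b0)// -mul2n exprM exprn_ge0// sqr_ge0.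
by rewrite -lerN2 -!odd_powerN lerXn2r ?nnegrE ?oppr_ge0 ?(ltW a0) ?(ltW b0)// lerN2.
Qed.

(** With [j s = s^(2m+1)], the second term is [P a - P b] for [P' s = s^2 j' s]:
testing with [j] gives the first term, and [P a - P b] is an exact difference
that integrates to zero against [G (x - y)]. *)
Definition flux_defect m a b : R :=
  (a ^+ m.*2.+1 - b ^+ m.*2.+1) * ((a + b) / 2) ^+ 2 -
  m.*2.+1%:R / m.*2.+3%:R * (a ^+ m.*2.+3 - b ^+ m.*2.+3).

(** As a polynomial in [a] this vanishes at [a = b].  For [a >= b] and [|s| <= 1] its
derivative is a sum of two products of nonnegative factors, as [s ((a + b) / 2)]
and [s ((b + 3 a) / 4)] lie in [[-M, M]], and the second arises from
[((a + b) / 2)^2 - a^2 = - (a - b) ((b + 3 a) / 4)]. *)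
Let defect_poly m M b s : {poly R} :=
  M *: (('X - b%:P) * ('X^(m.*2.+1) - (b ^+ m.*2.+1)%:P)) +
  s *: (('X^(m.*2.+1) - (b ^+ m.*2.+1)%:P) * (1 / 4 *: ('X + b%:P) ^+ 2) -
        (m.*2.+1%:R / m.*2.+3%:R) *: ('X^(m.*2.+3) - (b ^+ m.*2.+3)%:P)).

Let defect_polyE m M b s a : (defect_poly m M b s).[a] =
  M * ((a - b) * (a ^+ m.*2.+1 - b ^+ m.*2.+1)) + s * flux_defect m a b.
Proof.
rewrite /defect_poly /flux_defect.
rewrite !(hornerD, hornerN, hornerX, hornerC, horner_exp, hornerXn, hornerZ, hornerM).
congr (_ + s * _); congr (_ * _ - _); by field.
Qed.

Let defect_poly_deriv m M b s a : (defect_poly m M b s)^`().[a] =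
  (a ^+ m.*2.+1 - b ^+ m.*2.+1) * (M + s * ((a + b) / 2)) +
  m.*2.+1%:R * (a ^+ m) ^+ 2 * (a - b) * (M - s * ((b + 3 * a) / 4)).
Proof.
rewrite /defect_poly !(derivD, derivN, derivZ, derivM, derivC, derivX, derivXn, deriv_exp) !succnK.
rewrite !(hornerMn, hornerD, hornerN, hornerX, hornerC, horner_exp, hornerXn, hornerZ, hornerM).
rewrite -!(mulr_natr (a ^+ _) m.*2.+1) -!(mulr_natr (a ^+ _) m.*2.+3).
have e1 : a ^+ m.*2 = (a ^+ m) ^+ 2 by rewrite -exprM muln2.
have e2 : a ^+ m.*2.+2 = (a ^+ m) ^+ 2 * a ^+ 2 by rewrite -e1 -exprD addn2.
have e3 : a ^+ m.*2.+1 = (a ^+ m) ^+ 2 * a by rewrite -e1 exprSr.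
have p0 : m.*2.+3%:R != 0 :> R by rewrite pnatr_eq0.
have e4 : m.*2.+1%:R = m.*2.+3%:R - 2 :> R by rewrite -addn2 natrD addrK.
rewrite e2 e3 e1.
set q := m.*2.+3%:R in p0 e4 *; set d := m.*2.+1%:R; set A := a ^+ m; set B := b ^+ _.
by field.
Qed.

Lemma defect_ge0 m M b s a : `|s| <= 1 -> `|a| <= M -> `|b| <= M -> b <= a ->
  0 <= M * ((a - b) * (a ^+ m.*2.+1 - b ^+ m.*2.+1)) + s * flux_defect m a b.
Proof.
move=> s1 aM bM ba.
have p0 : (defect_poly m M b s).[b] = 0.
  by rewrite defect_polyE /flux_defect !subrr !(mul0r, mulr0, subr0, addr0).
rewrite -defect_polyE -p0.
have [c cab] := @MVT_segment R (horner (defect_poly m M b s))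
  (horner (defect_poly m M b s)^`()) b a ba (fun x _ => is_derive_poly _ _)
  (continuous_subspaceT (@continuous_horner _ _)).
rewrite -subr_ge0 => ->; rewrite mulr_ge0// ?subr_ge0//.
move: cab; rewrite in_itv/= => /andP[bc ca].
have cM : `|c| <= M.
  move: aM bM; rewrite !ler_norml => /andP[? ?] /andP[? ?].
  by apply/andP; split; lra.
have sx x : `|x| <= M -> `|s * x| <= M.
  by move=> xM; rewrite normrM -[leRHS]mul1r ler_pM.
rewrite defect_poly_deriv addr_ge0//.
  apply: mulr_ge0; first by rewrite subr_ge0 odd_power_mono.
  have : `|s * ((c + b) / 2)| <= M.
    apply: sx; move: cM bM; rewrite !ler_norml => /andP[? ?] /andP[? ?].
    by apply/andP; split; lra.
  by rewrite ler_norml => /andP[]; lra.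
apply: mulr_ge0.
  by rewrite mulr_ge0 ?subr_ge0// mulr_ge0// sqr_ge0.
have : `|s * ((b + 3 * c) / 4)| <= M.
  apply: sx; move: cM bM; rewrite !ler_norml => /andP[? ?] /andP[? ?].
  by apply/andP; split; lra.
by rewrite ler_norml => /andP[]; lra.
Qed.

Lemma flux_defectC m a b : flux_defect m b a = - flux_defect m a b.
Proof. by rewrite /flux_defect [b + a]addrC; ring. Qed.

Lemma flux_defect_le m M a b : `|a| <= M -> `|b| <= M ->
  `|flux_defect m a b| <= M * ((a - b) * (a ^+ m.*2.+1 - b ^+ m.*2.+1)).
Proof.
wlog ba : a b / b <= a.
  move=> H aM bM; have [ba|ab] := lerP b a; first exact: H.
  rewrite flux_defectC normrN.
  have -> : (a - b) * (a ^+ m.*2.+1 - b ^+ m.*2.+1) =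
            (b - a) * (b ^+ m.*2.+1 - a ^+ m.*2.+1) by ring.
  by apply: H => //; exact: ltW.
move=> aM bM.
have := @defect_ge0 m M b 1 a; rewrite normr1 lexx => /(_ isT aM bM ba).
have := @defect_ge0 m M b (-1) a; rewrite normrN normr1 lexx => /(_ isT aM bM ba).
by rewrite ler_norml => ? ?; apply/andP; split; lra.
Qed.

Lemma subrX_le n (a b : R) : 0 <= b <= a ->
  a ^+ n.+1 - b ^+ n.+1 <= n.+1%:R * (a - b) * a ^+ n.
Proof.
move=> /andP[b0 ba]; have a0 : 0 <= a := le_trans b0 ba.
elim: n => [|n IH]; first by rewrite !expr1 expr0 mul1r mulr1.
have h1 : a * (a ^+ n.+1 - b ^+ n.+1) <= a * (n.+1%:R * (a - b) * a ^+ n).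
  exact: ler_wpM2l.
have h2 : (a - b) * b ^+ n.+1 <= (a - b) * a ^+ n.+1.
  by rewrite ler_wpM2l ?subr_ge0// lerXn2r.
rewrite exprS [b ^+ n.+2]exprS.
have -> : n.+2%:R = n.+1%:R + 1 :> R by rewrite -[n.+2]addn1 natrD.
have e : a * (n.+1%:R * (a - b) * a ^+ n) = n.+1%:R * (a - b) * a ^+ n.+1.
  by rewrite exprS; ring.
rewrite e in h1.
move: h1 h2; set A := a ^+ n.+1; set B := b ^+ n.+1.
by set X := n.+1%:R * (a - b) * A => h1 h2; rewrite !mulrDl mul1r -/X; lra.
Qed.

(** For [0 <= b <= a], the increment [a^n - b^n] is at most [n (a - b) a^(n-1)] and
[a^(n-1) (a^n - b^n) <= a^(2n-1) - b^(2n-1)].  For opposite signs,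
[(x^n + y^n)^2 <= 2 (x^(2n) + y^(2n))] suffices. *)
Lemma stroock_varadhan m (a b : R) :
  (a ^+ m.+1 - b ^+ m.+1) ^+ 2 <=
  m.+1.*2%:R * ((a - b) * (a ^+ m.*2.+1 - b ^+ m.*2.+1)).
Proof.
have pos (x y : R) : 0 <= y <= x ->
    (x ^+ m.+1 - y ^+ m.+1) ^+ 2 <=
    m.+1.*2%:R * ((x - y) * (x ^+ m.*2.+1 - y ^+ m.*2.+1)).
  move=> yx; have /andP[y0 xy] := yx; have x0 := le_trans y0 xy.
  have h1 := @subrX_le m x y yx.
  have h0 : 0 <= x ^+ m.+1 - y ^+ m.+1 by rewrite subr_ge0 lerXn2r.
  have h2 : x ^+ m * (x ^+ m.+1 - y ^+ m.+1) <= x ^+ m.*2.+1 - y ^+ m.*2.+1.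
    rewrite mulrBr -exprD addnS addnn lerB// -addnn -addnS exprD.
    by rewrite ler_wpM2r ?exprn_ge0// lerXn2r.
  rewrite expr2; apply: le_trans (_ : (m.+1%:R * (x - y) * x ^+ m) *
    (x ^+ m.+1 - y ^+ m.+1) <= _); first exact: ler_wpM2r.
  rewrite -mulrA; apply: le_trans (_ : m.+1%:R * (x - y) *
    (x ^+ m.*2.+1 - y ^+ m.*2.+1) <= _).
    by rewrite ler_wpM2l// mulr_ge0// subr_ge0.
  rewrite -mulrA ler_wpM2r//; last by rewrite ler_nat -addnn leq_addr.
  by rewrite mulr_ge0 ?subr_ge0// odd_power_mono.
have opp (x y : R) : 0 <= x -> 0 <= y ->
    (x ^+ m.+1 - (- y) ^+ m.+1) ^+ 2 <=
    m.+1.*2%:R * ((x + y) * (x ^+ m.*2.+1 + y ^+ m.*2.+1)).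
  move=> x0 y0.
  have e1 : `|x ^+ m.+1 - (- y) ^+ m.+1| <= x ^+ m.+1 + y ^+ m.+1.
    by rewrite (le_trans (ler_normB _ _))// !normrX normrN !ger0_norm.
  apply: le_trans (_ : (x ^+ m.+1 + y ^+ m.+1) ^+ 2 <= _).
    by rewrite -real_normK ?num_real// lerXn2r ?nnegrE// addr_ge0// exprn_ge0.
  have X0 : 0 <= x ^+ m.*2.+1 by rewrite exprn_ge0.
  have Y0 : 0 <= y ^+ m.*2.+1 by rewrite exprn_ge0.
  apply: le_trans (_ : 2 * ((x + y) * (x ^+ m.*2.+1 + y ^+ m.*2.+1)) <= _).
    have ex (z : R) : (z ^+ m.+1) ^+ 2 = z * z ^+ m.*2.+1.
      by rewrite -exprM -exprS muln2.
    have xy0 : 0 <= x * y ^+ m.*2.+1 by rewrite mulr_ge0.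
    have yx0 : 0 <= y * x ^+ m.*2.+1 by rewrite mulr_ge0.
    have sq := sqr_ge0 (x ^+ m.+1 - y ^+ m.+1).
    move: sq; rewrite sqrrB sqrrD !ex.
    by lra.
  rewrite ler_wpM2r//; first by rewrite mulr_ge0// addr_ge0.
  by rewrite ler_nat doubleS.
wlog ba : a b / b <= a.
  move=> H; have [ba|ab] := lerP b a; first exact: H.
  have -> : (a - b) * (a ^+ m.*2.+1 - b ^+ m.*2.+1) =
            (b - a) * (b ^+ m.*2.+1 - a ^+ m.*2.+1) by ring.
  by rewrite -sqrrN opprB; apply: H; exact: ltW.
have [b0|b0] := lerP 0 b; first by apply: pos; rewrite b0.
have [a0|a0] := lerP 0 a.
  have := @opp a (- b) a0; rewrite oppr_ge0 (ltW b0) => /(_ isT).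
  by rewrite opprK odd_powerN.
have := @pos (- b) (- a); rewrite oppr_ge0 (ltW a0) lerN2 ba => /(_ isT).
rewrite !odd_powerN => H; apply: le_trans (_ : ((- b) ^+ m.+1 - (- a) ^+ m.+1) ^+ 2 <= _).
  rewrite (exprNn a) (exprNn b) -mulrBr exprMn -exprM -signr_odd oddM andbF expr0 mul1r.
  by rewrite -[leRHS]sqrrN opprB.
apply: (le_trans H); rewrite le_eqVlt; apply/orP; left; apply/eqP.
by congr (_ * _); ring.
Qed.

End scalar_inequalities.

(** * Symmetrization and the energy inequality *)

Section symmetrization.
Context {R : realType}.
Local Notation mu := (@lebesgue_measure R).
Local Notation intg f := (mu.-integrable setT (EFin \o f)).
Context {k f : R -> R} {B : R}.
Hypothesis k0 : forall x, 0 <= k x.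
Hypothesis kE : forall x, k (- x) = k x.
Hypothesis ki : intg k.
Hypothesis fi : intg f.
Hypothesis fB : forall x, `|f x| <= B.

Lemma transpose_measurable (H : R -> R -> R) :
  measurable_fun setT (fun p : R * R => H p.1 p.2) ->
  measurable_fun setT (fun p : R * R => H p.2 p.1).
Proof.
move=> mH; apply: (measurableT_comp mH (g := fun p : R * R => (p.2, p.1))).
by apply: measurable_fun_pair; [exact: measurable_snd|exact: measurable_fst].
Qed.

Lemma double_integral_symm (H : R -> R -> R) :
  measurable_fun setT (fun p : R * R => H p.1 p.2) ->
  (forall x y, `|H x y| <= k (x - y) * (`|f x| + `|f y|)) ->
  2 * \int[mu]_x \int[mu]_y H x y = \int[mu]_x \int[mu]_y (H x y + H y x).
Proof.
move=> mH Hle.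
have mT := transpose_measurable mH.
have Tle x y : `|H y x| <= k (x - y) * (`|f x| + `|f y|).
  by rewrite (le_trans (Hle y x))// -kE opprB [X in _ * X]addrC.
have S := Rintegral_swap k0 ki fi fB mH Hle.
rewrite mulr_natl mulr2n {2}S -RintegralD//; last 2 first.
- exact: (intg_inner k0 ki fi fB mH Hle).
- exact: (intg_inner k0 ki fi fB (H := fun x y => H y x) mT Tle).
apply: eq_Rintegral => x _; rewrite RintegralD//.
- exact: (intg_slice1 k0 ki fB mH Hle x).
- exact: (intg_slice1 k0 ki fB (H := fun x y => H y x) mT Tle x).
Qed.

(** The energy estimate holds pointwise only after adding the contributions of
[(x, y)] and [(y, x)]. *)
Lemma double_integral_symm_le (H H' : R -> R -> R) :
  measurable_fun setT (fun p : R * R => H p.1 p.2) ->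
  measurable_fun setT (fun p : R * R => H' p.1 p.2) ->
  (forall x y, `|H x y| <= k (x - y) * (`|f x| + `|f y|)) ->
  (forall x y, `|H' x y| <= k (x - y) * (`|f x| + `|f y|)) ->
  (forall x y, H x y + H y x <= H' x y + H' y x) ->
  \int[mu]_x \int[mu]_y H x y <= \int[mu]_x \int[mu]_y H' x y.
Proof.
move=> mH mH' Hle Hle' HH'.
rewrite -(ler_pM2l (ltr0Sn R 1)).
rewrite (double_integral_symm mH Hle) (double_integral_symm mH' Hle').
have T (L : R -> R -> R) : (forall x y, `|L x y| <= k (x - y) * (`|f x| + `|f y|)) ->
    forall x y, `|L x y + L y x| <= 2 * k (x - y) * (`|f x| + `|f y|).
  move=> Lle x y; rewrite (le_trans (ler_normD _ _))//.
  have := Lle x y; have := Lle y x; rewrite -[y - x]opprB kE [`|f y| + _]addrC.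
  by lra.
have k20 x : 0 <= 2 * k x by rewrite mulr_ge0.
have ki2 : intg (fun x => 2 * k x) by exact: intgZl.
have mS (L : R -> R -> R) : measurable_fun setT (fun p : R * R => L p.1 p.2) ->
    measurable_fun setT (fun p : R * R => L p.1 p.2 + L p.2 p.1).
  by move=> mL; apply: measurable_funD => //; exact: transpose_measurable.
apply: le_Rintegral => //.
- exact: (@intg_inner _ _ _ _ k20 ki2 fi fB (fun x y => H x y + H y x) (mS _ mH) (T _ Hle)).
- exact: (@intg_inner _ _ _ _ k20 ki2 fi fB (fun x y => H' x y + H' y x) (mS _ mH') (T _ Hle')).
move=> x _; apply: le_Rintegral => //.
- exact: (@intg_slice1 _ _ _ _ k20 ki2 fB (fun x y => H x y + H y x) (mS _ mH) (T _ Hle) x).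
- exact: (@intg_slice1 _ _ _ _ k20 ki2 fB (fun x y => H' x y + H' y x) (mS _ mH') (T _ Hle') x).
Qed.

End symmetrization.

Section dirichlet_form.
Context {R : realType} {K G : R -> R} {C : R}.
Hypothesis hKG : admissible_kernels K G C.
Local Notation mu := (@lebesgue_measure R).
Local Notation intg f := (mu.-integrable setT (EFin \o f)).

Definition dirichlet (w : R -> R) : R :=
  \int[mu]_x \int[mu]_y (K (x - y) * (w x - w y) ^+ 2).

Lemma dirichlet_measurable (w : R -> R) : measurable_fun setT w ->
  measurable_fun setT (fun p : R * R => K (p.1 - p.2) * (w p.1 - w p.2) ^+ 2).
Proof.
move=> mw; apply: measurable_funM.
  exact: measurable_conv_kernel (intg_measurable (kernelK_intg hKG)).
apply: measurable_funX; apply: measurable_funB; apply: (measurableT_comp mw).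
  exact: measurable_fst.
exact: measurable_snd.
Qed.

Lemma dirichlet_dominated (w : R -> R) (B : R) x y : (forall x, `|w x| <= B) ->
  `|K (x - y) * (w x - w y) ^+ 2| <= 2 * B * K (x - y) * (`|w x| + `|w y|).
Proof.
move=> wB; have k0 := kernelK_ge0 hKG (x - y).
rewrite normrM (ger0_norm k0) [2 * B * _]mulrC -mulrA ler_wpM2l//.
rewrite normrX expr2 ler_pM//.
  by rewrite (le_trans (ler_normB _ _))// mulr_natl mulr2n lerD.
exact: ler_normB.
Qed.

Lemma dirichletE (w : R -> R) (B : R) : intg w -> (forall x, `|w x| <= B) ->
  ((dirichlet w)%:E =
   \int[mu]_x \int[mu]_y (K (x - y) * (w x - w y) ^+ 2)%:E)%E.
Proof.
move=> iw wB.
have B0 : 0 <= B := le_trans (normr_ge0 _) (wB 0).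
have mw := intg_measurable iw.
have k0 x : 0 <= 2 * B * K x by rewrite !mulr_ge0//; exact: (kernelK_ge0 hKG).
have ki : intg (fun x => 2 * B * K x) by exact/intgZl/(kernelK_intg hKG).
have mH := dirichlet_measurable mw.
have Hle x y := dirichlet_dominated x y wB.
rewrite intg_fineK; last first.
  exact: (@intg_inner _ _ _ _ k0 ki iw wB
    (fun x y => K (x - y) * (w x - w y) ^+ 2) mH Hle).
apply: eq_integral => x _; rewrite intg_fineK//.
exact: (@intg_slice1 _ _ _ _ k0 ki wB
    (fun x y => K (x - y) * (w x - w y) ^+ 2) mH Hle x).
Qed.

Lemma dirichlet_ge0 (w : R -> R) : 0 <= dirichlet w.
Proof.
apply: Rintegral_ge0 => x _; apply: Rintegral_ge0 => y _.
by rewrite mulr_ge0 ?sqr_ge0//; exact: (kernelK_ge0 hKG).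
Qed.

(** Diffusion contributes [- k (a - b) (j a - j b)], and the defect costs at most
the fraction [C M] of it.  The last term on the right is the exact difference. *)
Lemma energy_pointwise m (M k g a b : R) : 0 <= k -> `|g| <= C * k -> C * M <= 1 ->
  `|a| <= M -> `|b| <= M ->
  a ^+ m.*2.+1 * (k * (b - a) + g * ((b + a) / 2) ^+ 2) +
  b ^+ m.*2.+1 * (k * (a - b) + (- g) * ((a + b) / 2) ^+ 2) <=
  - ((1 - C * M) / m.+1.*2%:R) * (k * (a ^+ m.+1 - b ^+ m.+1) ^+ 2) +
  m.*2.+1%:R / m.*2.+3%:R * (g * (a ^+ m.*2.+3 - b ^+ m.*2.+3)).
Proof.
move=> k0 gk CM aM bM.
set P := (a - b) * (a ^+ m.*2.+1 - b ^+ m.*2.+1).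
have defect : g * flux_defect m a b <= C * M * (k * P).
  rewrite (le_trans (ler_norm _))// normrM.
  rewrite (_ : C * M * (k * P) = (C * k) * (M * P)); last by ring.
  by apply: ler_pM => //; exact: flux_defect_le.
have sv : (a ^+ m.+1 - b ^+ m.+1) ^+ 2 / m.+1.*2%:R <= P.
  by rewrite ler_pdivrMr ?ltr0n// mulrC; exact: stroock_varadhan.
have kw : (1 - C * M) * (k * ((a ^+ m.+1 - b ^+ m.+1) ^+ 2 / m.+1.*2%:R)) <=
          (1 - C * M) * (k * P).
  by rewrite ler_wpM2l ?subr_ge0// ler_wpM2l.
rewrite -subr_ge0.
rewrite (_ : _ - _ = (C * M * (k * P) - g * flux_defect m a b) +
  ((1 - C * M) * (k * P) -
   (1 - C * M) * (k * ((a ^+ m.+1 - b ^+ m.+1) ^+ 2 / m.+1.*2%:R)))).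
  by rewrite addr_ge0// subr_ge0.
rewrite /flux_defect /P.
set X := m.*2.+1%:R / _; set Y := m.+1.*2%:R^-1.
by field.
Qed.

Lemma energy_inequality (v : R -> R) (M : R) m :
  intg v -> (forall x, `|v x| <= M) -> C * M <= 1 ->
  \int[mu]_x (v x ^+ m.*2.+1 * nonlocal_rhs K G v x) <=
  - ((1 - C * M) / m.+1.*2%:R / 2) * dirichlet (fun x => v x ^+ m.+1).
Proof.
move=> iv vM CM; have mv := intg_measurable iv.
have M0 : 0 <= M := le_trans (normr_ge0 _) (vM 0).
have C0 := kernel_const_ge0 hKG.
pose kap := (1 - C * M) / m.+1.*2%:R.
have kap0 : 0 <= kap by rewrite divr_ge0// subr_ge0.
have kap1 : kap <= 1.
  rewrite ler_pdivrMr ?ltr0n// mul1r; apply: le_trans (_ : 1 <= _).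
    by rewrite gerBl mulr_ge0.
  by rewrite ler1n.
pose w x := v x ^+ m.+1.
have wM x : `|w x| <= M ^+ m.+1 by rewrite normrX lerXn2r// nnegrE.
have iw : intg w by exact: (@intg_pow _ _ M).
have mw := intg_measurable iw.
pose I x y := v x ^+ m.*2.+1 * flux (K := K) (G := G) v x y.
pose N x y := m.*2.+1%:R / m.*2.+3%:R * v x ^+ m.*2.+3 * G (x - y).
pose E x y := K (x - y) * (w x - w y) ^+ 2.
pose H' x y := - (kap / 2) * E x y + N x y.
pose c := 4 * M ^+ m.*2.+1 + C * M ^+ m.*2.+2.
have M1 : 0 <= M ^+ m.*2.+1 by exact: exprn_ge0.
have M2 : 0 <= C * M ^+ m.*2.+2 by rewrite mulr_ge0// exprn_ge0.
have c0 : 0 <= c by rewrite addr_ge0// mulr_ge0.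
pose k x := c * K x.
have k0 x : 0 <= k x by rewrite mulr_ge0//; exact: (kernelK_ge0 hKG).
have ki : intg k by exact/intgZl/(kernelK_intg hKG).
have kE x : k (- x) = k x by rewrite /k (kernelK_even hKG).
have vX n x : `|v x| ^+ n <= M ^+ n by rewrite lerXn2r// nnegrE.
have S0 x y : 0 <= K (x - y) * (`|v x| + `|v y|).
  by rewrite mulr_ge0 ?addr_ge0//; exact: (kernelK_ge0 hKG).
have kS x y : k (x - y) * (`|v x| + `|v y|) =
    4 * (M ^+ m.*2.+1 * (K (x - y) * (`|v x| + `|v y|))) +
    C * M ^+ m.*2.+2 * (K (x - y) * (`|v x| + `|v y|)) by rewrite /k /c; ring.
have Ile x y : `|I x y| <= k (x - y) * (`|v x| + `|v y|).
  rewrite /I normrM normrX.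
  apply: le_trans (_ : M ^+ m.*2.+1 * (2 * K (x - y) * (`|v x| + `|v y|)) <= _).
    by apply: ler_pM; [exact: exprn_ge0|exact: normr_ge0|exact: vX|exact: (flux_le hKG)].
  have S1 := mulr_ge0 M1 (S0 x y); have S2 := mulr_ge0 M2 (S0 x y).
  rewrite [leLHS](_ : _ = 2 * (M ^+ m.*2.+1 * (K (x - y) * (`|v x| + `|v y|)))); last by ring.
  by rewrite kS; lra.
have Ele x y : `|E x y| <= 2 * M ^+ m.*2.+1 * (K (x - y) * (`|v x| + `|v y|)).
  apply: le_trans (dirichlet_dominated x y wM) _.
  rewrite -!mulrA ler_wpM2l// -addnn -addSn exprD -mulrA ler_wpM2l ?exprn_ge0//.
  rewrite mulrCA ler_wpM2l//; first exact: (kernelK_ge0 hKG).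
  rewrite mulrDr lerD// /w normrX exprS mulrC ler_wpM2r//.
have Nle x y : `|N x y| <= C * M ^+ m.*2.+2 * (K (x - y) * (`|v x| + `|v y|)).
  rewrite /N (normrM _ (G _)) (normrM _ (v x ^+ _)) (normrX _ (v x)).
  rewrite (ger0_norm (_ : 0 <= m.*2.+1%:R / m.*2.+3%:R)) ?divr_ge0//.
  have g1 := kernelG_le hKG (x - y).
  have q1 : m.*2.+1%:R / m.*2.+3%:R <= 1 :> R.
    by rewrite ler_pdivrMr ?ltr0n// mul1r ler_nat leqW// leqW.
  apply: le_trans (_ : (1 * (M ^+ m.*2.+2 * `|v x|)) * (C * K (x - y)) <= _).
    apply: ler_pM => //.
    apply: ler_pM; rewrite ?exprn_ge0 ?divr_ge0//.
    by rewrite exprSr ler_wpM2r// vX.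
  rewrite mul1r (_ : _ * _ = C * M ^+ m.*2.+2 * (K (x - y) * `|v x|)); last by ring.
  rewrite ler_wpM2l// ler_wpM2l//; first exact: (kernelK_ge0 hKG).
  by rewrite lerDl.
have H'le x y : `|H' x y| <= k (x - y) * (`|v x| + `|v y|).
  rewrite /H' (le_trans (ler_normD _ _))// normrM normrN (ger0_norm (_ : 0 <= kap / 2)).
    have e1 := Ele x y; have n1 := Nle x y; have S1 := mulr_ge0 M1 (S0 x y).
    have e2 : kap / 2 * `|E x y| <= `|E x y| by rewrite ler_piMl//; lra.
    by rewrite kS; rewrite -mulrA in e1; lra.
  by rewrite divr_ge0.
have mI : measurable_fun setT (fun p : R * R => I p.1 p.2).
  apply: measurable_funM; last exact: (measurable_flux hKG).
  by apply: measurable_funX; apply: (measurableT_comp mv); exact: measurable_fst.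
have mE : measurable_fun setT (fun p : R * R => E p.1 p.2) by exact: dirichlet_measurable.
have mH' : measurable_fun setT (fun p : R * R => H' p.1 p.2).
  apply: measurable_funD; first exact: measurable_funM.
  apply: measurable_funM.
    by apply: measurable_funM => //; apply: measurable_funX;
      apply: (measurableT_comp mv); exact: measurable_fst.
  exact: measurable_conv_kernel (intg_measurable (kernelG_intg hKG)).
have -> : \int[mu]_x (v x ^+ m.*2.+1 * nonlocal_rhs K G v x) =
          \int[mu]_x \int[mu]_y I x y.
  apply: eq_Rintegral => x _; rewrite (nonlocal_rhsE hKG mv vM) RintegralZl//.
  exact: (flux_intg hKG mv vM).
have -> : - ((1 - C * M) / m.+1.*2%:R / 2) * dirichlet (fun x => v x ^+ m.+1) =
          \int[mu]_x \int[mu]_y H' x y.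
  have k0' x : 0 <= 2 * M ^+ m.*2.+1 * K x.
    by rewrite !mulr_ge0//; exact: (kernelK_ge0 hKG).
  have ki' : intg (fun x => 2 * M ^+ m.*2.+1 * K x) by exact/intgZl/(kernelK_intg hKG).
  have Ele' x y : `|E x y| <= 2 * M ^+ m.*2.+1 * K (x - y) * (`|v x| + `|v y|).
    by rewrite -mulrA; exact: Ele.
  rewrite /dirichlet -RintegralZl//; last exact: (intg_inner k0' ki' iv vM mE Ele').
  apply: eq_Rintegral => x _; rewrite RintegralD//; last 2 first.
  - exact/intgZl/(intg_slice1 k0' ki' vM mE Ele' x).
  - exact/intgZl/(kernelG_slice hKG).
  rewrite RintegralZl//; last exact: (intg_slice1 k0' ki' vM mE Ele' x).
  rewrite RintegralZl//; last exact: (kernelG_slice hKG).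
  by rewrite (kernelG_slice_mass hKG) mulr0 addr0.
apply: (double_integral_symm_le k0 kE ki iv vM mI mH' Ile H'le) => x y.
have gk := kernelG_le hKG (x - y).
have := @energy_pointwise m M (K (x - y)) (G (x - y)) (v x) (v y)
  (kernelK_ge0 hKG (x - y)) gk CM (vM x) (vM y).
rewrite /I /H' /N /E /flux -[y - x]opprB (kernelK_even hKG) (kernelG_odd hKG).
rewrite -/kap /w; move/le_trans; apply.
rewrite le_eqVlt; apply/orP; left; apply/eqP.
set X := m.*2.+1%:R / _.
by field.
Qed.

End dirichlet_form.

(** * Steinhaus theorem *)

Section steinhaus.
Context {R : realType}.
Local Notation mu := (@lebesgue_measure R).
Local Open Scope ereal_scope.

(** Enclose [F] in an open [U] with [mu (U \ F) < mu F / 2].  By compactness small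
translates of [F] stay in [U], where they leave too little room to miss half of [F]. *)
Lemma steinhaus (F : set R) : compact F -> 0 < mu F ->
  exists2 d : R, (0 < d)%R & forall z : R, (`|z| <= d)%R ->
    mu F <= 2%:E * mu (F `&` (fun x => (x - z)%R) @^-1` F).
Proof.
move=> cF F0.
have mF : measurable F := compact_measurable cF.
have Fy : mu F < +oo := compact_finite_measure cF.
have Ffin : mu F \is a fin_num by rewrite ge0_fin_numE.
have e0 : (0 < fine (mu F) / 2)%R by rewrite divr_gt0// fine_gt0// F0.
have [U [oU FU UF]] := lebesgue_regularity_outer mF Fy e0.
have cov := (compact_near_coveringP F).1 cF R (nbhs (0%R : R)) (fun z x => U (x + z)%R) _.
have near0 : \forall z \near (0%R : R), F `<=` (fun x => U (x + z)%R).
  apply: cov => x Fx.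
  have Ux : nbhs (x + 0)%R U.
    by rewrite addr0; apply: open_nbhs_nbhs; split => //; exact: FU.
  exact: (@add_continuous R (x, 0%R) U Ux).
case: near0 => d /= d0 dU.
exists (d / 2)%R; first by rewrite divr_gt0.
move=> z zd.
have FzU : (fun x => (x - z)%R) @^-1` F `<=` U.
  move=> y /= Fy'; have := dU z _ _ Fy'; rewrite subrK; apply.
  rewrite /= sub0r normrN (le_lt_trans zd)//.
  by rewrite ltr_pdivrMr// ltr_pMr// ltr1n.
have mG : measurable ((fun x => (x - z)%R) @^-1` F).
  rewrite -[X in measurable X]setTI.
  by apply: (measurable_funB (@measurable_id _ R setT) (measurable_cst z)).
have mFz : mu ((fun x => (x - z)%R) @^-1` F) = mu F.
  exact: (lebesgue_measure_shift (- z) mF).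
have mU : measurable U := open_measurable oU.
have sub : (fun x => (x - z)%R) @^-1` F `<=`
    (F `&` (fun x => (x - z)%R) @^-1` F) `|` (U `\` F).
  by move=> y Gy; have [Fy'|Fy'] := pselect (F y); [left|right; split => //; exact: FzU].
have mI : measurable (F `&` (fun x => (x - z)%R) @^-1` F) by exact: measurableI.
have : mu F <= mu (F `&` (fun x => (x - z)%R) @^-1` F) + mu (U `\` F).
  rewrite -{1}mFz; apply: le_trans (measureU2 _ _ _) => //; last exact: measurableD.
  by apply: le_measure; rewrite ?inE//; apply: measurableU => //; exact: measurableD.
have Ify : mu (F `&` (fun x => (x - z)%R) @^-1` F) \is a fin_num.
  rewrite ge0_fin_numE//; apply: le_lt_trans Fy.
  by apply: le_measure; rewrite ?inE//; exact: subIsetl.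
have Dfy : mu (U `\` F) \is a fin_num.
  by rewrite ge0_fin_numE//; exact: lt_trans UF (ltry _).
have {}UF : mu (U `\` F) < (fine (mu F) / 2)%:E := UF.
move: (mu F) Ffin (mu (F `&` _)) Ify (mu (U `\` F)) Dfy UF.
move=> [f||]// _ [i||]// _ [u||]// _ /=; rewrite lte_fin -EFinD -EFinM !lee_fin; lra.
Qed.

End steinhaus.

Section positive_level.
Context {R : realType}.
Local Notation mu := (@lebesgue_measure R).
Local Notation intg f := (mu.-integrable setT (EFin \o f)).

(** Some set [k >= 1 / (n + 1)] has positive measure, and finite measure by
Markov's inequality; inner regularity does the rest. *)
Lemma compact_positive_level (k : R -> R) : intg k -> (forall x, 0 <= k x) ->
  \int[mu]_x k x != 0 ->
  exists F (c : R), [/\ compact F, (0 < mu F)%E, 0 < c & forall x, F x -> c <= k x].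
Proof.
move=> ki k0 kn0; have mk := intg_measurable ki.
pose A n := [set x | n.+1%:R^-1 <= k x].
have mA n : measurable (A n).
  rewrite -[A n]setTI.
  rewrite (_ : [set: R] `&` A n = [set: R] `&` k @^-1` `[n.+1%:R^-1, +oo[%classic).
    by apply: mk => //; exact: measurable_itv.
  by congr (_ `&` _); apply/seteqP; split => x /=; rewrite /A/= in_itv/= andbT.
have [n An] : exists n, (0 < mu (A n))%E.
  apply: contrapT => /forallNP H.
  have A0 n : mu.-negligible (A n).
    have A0 : mu (A n) = 0%E.
      apply/eqP; rewrite eq_le measure_ge0 andbT leNgt.
      by apply/negP; exact: H.
    exists (A n); split; [exact: mA|exact: A0|exact: subset_refl].
  have := negligible_bigcup A0 => N.
  move: kn0; apply/negP; rewrite negbK; apply/eqP.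
  rewrite (@ae_eq_Rintegral _ k (fun=> 0)) ?Rintegral0//.
  apply: negligibleS N => x /= kx.
  have kx0 : 0 < k x by rewrite lt_neqAle k0 andbT; apply/negP => /eqP kx0; exact: kx.
  exists (Num.bound (k x)^-1) => //; rewrite /A /=.
  rewrite -[leRHS]invrK lef_pV2 ?posrE ?invr_gt0//.
  apply: ltW; apply: lt_le_trans (archi_boundP _) _; first by rewrite invr_ge0.
  by rewrite ler_nat.
have n0 : 0 < n.+1%:R^-1 :> R by rewrite invr_gt0.
have Any : (mu (A n) < +oo)%E.
  have := @le_integral_comp_abse _ _ _ mu setT measurableT (EFin \o k) n.+1%:R^-1 id
    (@measurable_id _ _ _) (fun r r0 => r0) (fun x y _ _ xy => xy)
    (measurable_int _ ki) n0.
  rewrite setTI.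
  rewrite (_ : [set x | _] = A n); last first.
    by apply/seteqP; split => x /=; rewrite lee_fin (ger0_norm (k0 _)).
  move=> /le_lt_trans H.
  have {H} : (n.+1%:R^-1%:E * mu (A n) < +oo)%E by apply: H; case/integrableP : ki.
  case: (mu (A n)) => [r _||] //; first by rewrite ltry.
  by rewrite gt0_muley// lte_fin.
have Anfin : mu (A n) \is a fin_num by rewrite ge0_fin_numE.
have e0 : 0 < fine (mu (A n)) / 2 by rewrite divr_gt0// fine_gt0// An Any.
have [F [cF FA AF]] := lebesgue_regularity_inner (mA n) Any e0.
have {}AF : (mu (A n `\` F) < (fine (mu (A n)) / 2)%:E)%E := AF.
have F0 : (0 < mu F)%E; last by exists F, n.+1%:R^-1; split => // x /FA.
rewrite lt_neqAle measure_ge0 andbT; apply/negP => /eqP F0.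
have mF : measurable F := compact_measurable cF.
have : (mu (A n) <= mu F + mu (A n `\` F))%E.
  rewrite -[X in (mu X <= _)%E](setDUK FA).
  by apply: measureU2; [exact: mF|exact: (measurableD (mA n) mF)].
rewrite -F0 add0e => /le_lt_trans/(_ AF) {AF}.
move: (mu (A n)) Anfin An; move=> [a||]// _; rewrite !lte_fin/=; lra.
Qed.

End positive_level.

(** * Translation modulus and Nash inequality *)

Section translation_modulus.
Context {R : realType}.
Local Notation mu := (@lebesgue_measure R).
Local Notation intg f := (mu.-integrable setT (EFin \o f)).
Context {w : R -> R} {B : R}.
Hypothesis iw : intg w.
Hypothesis wB : forall x, `|w x| <= B.

Definition modulus (v : R -> R) (z : R) : R := \int[mu]_x (v (x + z) - v x) ^+ 2.

Let mw : measurable_fun setT w. Proof. exact: intg_measurable. Qed.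

Lemma intg_shiftD c : intg (fun x => w (x + c)).
Proof.
by have := @integrable_shift _ (EFin \o w) (- c) iw; rewrite opprK.
Qed.

Lemma intg_modulus c d : intg (fun x => (w (x + c) - w (x + d)) ^+ 2).
Proof.
have e x : (w (x + c) - w (x + d)) ^+ 2 =
    (w (x + c) - w (x + d)) * (w (x + c) - w (x + d)) by rewrite expr2.
under eq_fun do rewrite e.
apply: (@intg_bounded _ _ _ (B + B)).
- by apply: intgB; exact: intg_shiftD.
- by apply: measurable_funB; apply: intg_measurable; exact: intg_shiftD.
- by move=> x; rewrite (le_trans (ler_normB _ _))// lerD.
Qed.

Lemma modulusE c d : \int[mu]_x (w (x + c) - w (x + d)) ^+ 2 = modulus w (c - d).
Proof.
rewrite /modulus /Rintegral; congr fine.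
rewrite -(@ge0_integral_shift _ (fun x => ((w (x + (c - d)) - w x) ^+ 2)%:E) d).
- by apply: eq_integral => x _; rewrite -addrA subrKC.
- apply/measurable_EFinP; apply: measurable_funX; apply: measurable_funB => //.
  exact: (intg_measurable (intg_shiftD _)).
- by move=> x; rewrite lee_fin sqr_ge0.
Qed.

Lemma modulus_ge0 z : 0 <= modulus w z.
Proof. by apply: Rintegral_ge0 => x _; exact: sqr_ge0. Qed.

Lemma modulusN z : modulus w (- z) = modulus w z.
Proof.
rewrite -[- z]sub0r -modulusE.
by apply: eq_Rintegral => x _; rewrite addr0 -sqrrN opprB.
Qed.

(** The weights [1 + s] and [1 + 1/s] come from Young's inequality for the cross
term; the choice [s = 1/n] then yields the factor [n^2] in [modulus_scale]. *)
Lemma modulus_triangle s z z' : 0 < s ->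
  modulus w (z + z') <= (1 + s) * modulus w z + (1 + s^-1) * modulus w z'.
Proof.
move=> s0.
have i1 := intg_modulus (z + z') z'; have i2 := intg_modulus z' 0.
rewrite -[X in modulus w X](subr0 (z + z')) -modulusE.
rewrite -[X in _ * modulus w X + _](addrK z' z) -modulusE.
rewrite -[X in _ + _ * modulus w X](subr0 z') -modulusE.
rewrite -!RintegralZl//.
rewrite -RintegralD//; try exact: intgZl.
apply: le_Rintegral => //.
- exact: intg_modulus.
- by apply: intgD; exact: intgZl.
move=> x _; set a := w (x + (z + z')); set b := w (x + z'); set c := w (x + 0).
have sq : 0 <= (s * (a - b) - (b - c)) ^+ 2 / s by rewrite divr_ge0 ?sqr_ge0// ltW.
rewrite -subr_ge0 (_ : _ - _ = (s * (a - b) - (b - c)) ^+ 2 / s)//.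
by field; rewrite gt_eqF.
Qed.

Lemma modulus_scale n z : modulus w (n.+1%:R * z) <= n.+1%:R ^+ 2 * modulus w z.
Proof.
elim: n => [|n IH]; first by rewrite mul1r expr1n mul1r.
have n0 : 0 < n.+1%:R^-1 :> R by rewrite invr_gt0.
have -> : n.+2%:R * z = n.+1%:R * z + z by rewrite -[n.+2]addn1 natrD mulrDl mul1r.
apply: le_trans (modulus_triangle _ _ n0) _; rewrite invrK.
have n1 : n.+1%:R != 0 :> R by [].
apply: le_trans (_ : (1 + n.+1%:R^-1) * (n.+1%:R ^+ 2 * modulus w z) +
  (1 + n.+1%:R) * modulus w z <= _).
  by rewrite lerD2r ler_wpM2l// addr_ge0// ltW.
rewrite -[n.+2]addn1 natrD le_eqVlt; apply/orP; left; apply/eqP.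
by set N := n.+1%:R in n1 *; field.
Qed.

Lemma measurable_shifted (v : R -> R) : measurable_fun setT v ->
  measurable_fun setT (fun p : R * R => v (p.2 + p.1)).
Proof.
move=> mv; apply: (measurableT_comp mv).
by apply: measurable_funD; [exact: measurable_snd|exact: measurable_fst].
Qed.

Lemma modulusEFin z :
  ((modulus w z)%:E = \int[mu]_x ((w (x + z) - w x) ^+ 2)%:E)%E.
Proof.
rewrite intg_fineK//; have := intg_modulus z 0.
by congr (mu.-integrable setT _); apply/funext => x /=; rewrite addr0.
Qed.

Lemma measurable_modulus : measurable_fun setT (modulus w).
Proof.
apply/measurable_EFinP.
rewrite (_ : _ \o _ = fun z => \int[mu]_x ((w (x + z) - w x) ^+ 2)%:E)%E; last first.
  by apply/funext => z; rewrite /= modulusEFin.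
apply: (@measurable_tonelli _ (fun z x => ((w (x + z) - w x) ^+ 2)%:E)).
  apply/measurable_EFinP; apply: measurable_funX; apply: measurable_funB.
    exact: measurable_shifted.
  by apply: (measurableT_comp mw); exact: measurable_snd.
by move=> x y; rewrite lee_fin sqr_ge0.
Qed.

End translation_modulus.

Section nash.
Context {R : realType} {K G : R -> R} {C : R}.
Hypothesis hKG : admissible_kernels K G C.
Local Notation mu := (@lebesgue_measure R).
Local Notation intg f := (mu.-integrable setT (EFin \o f)).

Lemma dirichlet_modulus (w : R -> R) (B : R) : intg w -> (forall x, `|w x| <= B) ->
  ((dirichlet (K := K) w)%:E = \int[mu]_z (K z * modulus w z)%:E)%E.
Proof.
move=> iw wB; rewrite (dirichletE hKG iw wB).
have mw := intg_measurable iw.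
have mK := intg_measurable (kernelK_intg hKG).
have K0 := kernelK_ge0 hKG.
have g0 (x y : R) : (0 <= (K (x - y) * (w x - w y) ^+ 2)%:E)%E.
  by rewrite lee_fin mulr_ge0// sqr_ge0.
rewrite (@tonelli_swap _ (fun x y => (K (x - y) * (w x - w y) ^+ 2)%:E))//; last first.
  by apply/measurable_EFinP; exact: (dirichlet_measurable hKG).
have step (y : R) : (\int[mu]_x (K (x - y) * (w x - w y) ^+ 2)%:E =
    \int[mu]_z (K z * (w (y + z) - w y) ^+ 2)%:E)%E.
  rewrite -(@ge0_integral_shift _ (fun x => (K (x - y) * (w x - w y) ^+ 2)%:E) y)//.
    by apply: eq_integral => z _; rewrite addrK [z + y]addrC.
  apply/measurable_EFinP; apply: measurable_funM.
    by apply: (measurableT_comp mK); exact: measurable_funB.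
  by apply: measurable_funX; exact: measurable_funB.
under eq_integral do rewrite step.
rewrite (@tonelli_swap _ (fun y z => (K z * (w (y + z) - w y) ^+ 2)%:E))//; last 2 first.
- apply/measurable_EFinP; apply: measurable_funM.
    by apply: (measurableT_comp mK); exact: measurable_snd.
  apply: measurable_funX; apply: measurable_funB.
    apply: (measurableT_comp mw).
    by apply: measurable_funD; [exact: measurable_fst|exact: measurable_snd].
  by apply: (measurableT_comp mw); exact: measurable_fst.
- by move=> x y; rewrite lee_fin mulr_ge0// sqr_ge0.
apply: eq_integral => z _.
rewrite EFinM (modulusEFin iw wB) -ge0_integralZl//.
- apply/measurable_EFinP; apply: measurable_funX; apply: measurable_funB => //.
  exact: (intg_measurable (intg_shiftD iw _)).
- by move=> x _; rewrite lee_fin sqr_ge0.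
- by rewrite lee_fin.
Qed.

(** On a compact set [F] where [K >= c], the average of the modulus is controlled by
the Dirichlet form.  A small [z] is the difference of [y] and [y - z], both in [F]
for a large set of [y] by Steinhaus' theorem; average the triangle inequality
over these [y]. *)
Lemma modulus_le_dirichlet : exists d a : R, [/\ 0 < d, 0 < a &
  forall (w : R -> R) (B : R), intg w -> (forall x, `|w x| <= B) ->
  forall z, `|z| <= d -> modulus w z <= a * dirichlet (K := K) w].
Proof.
have K0 := kernelK_ge0 hKG.
have Kn0 : \int[mu]_x K x != 0 by rewrite (kernelK_mass hKG) oner_eq0.
have [F [c [cF F0 c0 Fc]]] := compact_positive_level (kernelK_intg hKG) K0 Kn0.
have mF : measurable F := compact_measurable cF.
have [d d0 Fd] := steinhaus cF F0.
have Ffin : mu F \is a fin_num.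
  by rewrite ge0_fin_numE//; exact: (compact_finite_measure cF).
have f0 : 0 < fine (mu F).
  by rewrite fine_gt0// F0 /=; exact: (compact_finite_measure cF).
exists d, (8 / (c * fine (mu F))); split => //.
  by rewrite divr_gt0// mulr_gt0.
move=> w B iw wB z zd.
pose g (y : R) : R := \1_F y * modulus w y.
have g0 y : 0 <= g y by rewrite mulr_ge0// modulus_ge0.
have mgR : measurable_fun setT g.
  by apply: measurable_funM => //; exact: (measurable_modulus iw wB).
have mg : measurable_fun setT (EFin \o g) by exact/measurable_EFinP.
have gD : (\int[mu]_y (g y)%:E <= (c^-1 * dirichlet (K := K) w)%:E)%E.
  rewrite EFinM (dirichlet_modulus iw wB) -ge0_integralZl//; last 3 first.
  - apply/measurable_EFinP; apply: measurable_funM; last exact: (measurable_modulus iw wB).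
    exact: intg_measurable (kernelK_intg hKG).
  - by move=> y _; rewrite lee_fin mulr_ge0// modulus_ge0.
  - by rewrite lee_fin invr_ge0 ltW.
  apply: ge0_le_integral => //.
  - by move=> y _; rewrite lee_fin.
  - apply: measurable_funeM; apply/measurable_EFinP; apply: measurable_funM.
      exact: intg_measurable (kernelK_intg hKG).
    exact: (measurable_modulus iw wB).
  - move=> y _; rewrite -EFinM lee_fin /g indicE mulrA ler_wpM2r ?modulus_ge0//.
    case: (boolP (y \in F)) => [/set_mem/Fc cK|_] /=; last first.
      by rewrite mulr_ge0// invr_ge0 ltW.
    by rewrite ler_pdivlMl// mulr1.
pose S := F `&` (fun x => x - z) @^-1` F.
have mG : measurable ((fun x => x - z) @^-1` F).
  rewrite -[X in measurable X]setTI.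
  by apply: (measurable_funB (@measurable_id _ R setT) (measurable_cst z)).
have mS : measurable S by exact: measurableI.
have key : (mu S * (modulus w z)%:E <= (4 * (c^-1 * dirichlet (K := K) w))%:E)%E.
  rewrite muleC -integral_cst//.
  apply: le_trans (_ : (\int[mu]_y (2 * g y + 2 * g (y - z))%:E <= _)%E).
    rewrite integral_mkcond; apply: ge0_le_integral => //.
    - by move=> y _; rewrite patchE; case: ifP => // _; rewrite lee_fin modulus_ge0.
    - by apply/(measurable_restrictT _ mS); exact: measurable_cst.
    - apply/measurable_EFinP; apply: measurable_funD; apply: measurable_funM => //.
      by apply: (measurableT_comp mgR); exact: measurable_funB.
    - move=> y _; rewrite patchE; case: ifPn => [/set_mem[Fy /= Fyz]|_]; last first.
        by rewrite lee_fin addr_ge0// mulr_ge0.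
      rewrite lee_fin /g !indicE !mem_set//= !mul1r.
      have := modulus_triangle iw wB y (z - y) (ltr01 : (0 : R) < 1).
      rewrite subrKC invr1 -[z - y]opprB (modulusN iw) => tri.
      by apply: le_trans tri _; lra.
  have mgz : measurable_fun setT (fun y : R => (g (y - z))%:E).
    by apply: (measurableT_comp mg); exact: measurable_funB.
  have -> : (\int[mu]_y (2 * g y + 2 * g (y - z))%:E =
             2%:E * \int[mu]_y (g y)%:E + 2%:E * \int[mu]_y (g y)%:E)%E.
    rewrite -{2}(@ge0_integral_shift _ (fun y : R => (g y)%:E) (- z))//.
    rewrite -!ge0_integralZl//; try by move=> y _; rewrite lee_fin.
    rewrite -ge0_integralD//.
    - by move=> y _; rewrite -EFinM lee_fin mulr_ge0.
    - exact: measurable_funeM.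
    - by move=> y _; rewrite -EFinM lee_fin mulr_ge0.
    - exact: measurable_funeM.
  rewrite (_ : (4 * (c^-1 * dirichlet (K := K) w))%:E =
    2%:E * (c^-1 * dirichlet (K := K) w)%:E + 2%:E * (c^-1 * dirichlet (K := K) w)%:E)%E.
    by apply: leeD; exact: lee_wpmul2l.
  by rewrite -!EFinM -EFinD; congr EFin; ring.
have := Fd z zd; rewrite -/S.
have Sfin : mu S \is a fin_num.
  rewrite ge0_fin_numE//; apply: le_lt_trans (compact_finite_measure cF).
  by apply: le_measure; rewrite ?inE//; exact: subIsetl.
have O0 := modulus_ge0 (w := w) z.
have {Fd}H : forall f s : R, 0 < f -> f <= 2 * s -> s * modulus w z <= 4 * (c^-1 * dirichlet (K := K) w) ->
   modulus w z <= 8 / (c * f) * dirichlet (K := K) w.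
  move=> f s fp fs h.
  have : f * modulus w z <= 8 * (c^-1 * dirichlet (K := K) w).
    apply: le_trans (ler_wpM2r O0 fs) _; lra.
  rewrite (_ : 8 / (c * f) * _ = f^-1 * (8 * (c^-1 * dirichlet (K := K) w))).
    by rewrite ler_pdivlMl.
  by field; rewrite !gt_eqF.
move: (mu S) Sfin key => [s||]// _; move: (mu F) Ffin f0 => [f||]//= _ fp.
rewrite -!EFinM !lee_fin => h1 h2.
exact: H fp h2 h1.
Qed.

(** Compare [w x] with [w (x + z)] for all [z] in an interval of length [L]
proportional to [k]: the difference costs the modulus at [z], hence [k^2] times
the Dirichlet form, and the products [|w x| |w (x + z)|] integrate over [z] and
[x] to at most the square of the L^1 norm, which is divided by [L]. *)
Lemma nash_inequality : exists2 A : R, 0 < A &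
  forall (w : R -> R) (B : R) (k : nat), intg w -> (forall x, `|w x| <= B) ->
  \int[mu]_x (w x ^+ 2) <=
    A * (k.+1%:R ^+ 2 * dirichlet (K := K) w + (\int[mu]_x `|w x|) ^+ 2 / k.+1%:R).
Proof.
have [d [a [d0 a0 mod_le]]] := modulus_le_dirichlet.
exists (2 / d + 4 * a); first by rewrite addr_gt0// ?divr_gt0// mulr_gt0.
move=> w B k iw wB.
have mw := intg_measurable iw.
set D := dirichlet w; set I1 := \int[mu]_x `|w x|; set I2 := \int[mu]_x (w x ^+ 2).
have D0 : 0 <= D by exact: (dirichlet_ge0 hKG).
have I10 : 0 <= I1 by exact: Rintegral_ge0.
pose L := k.+1%:R * d.
have L0 : 0 < L by rewrite mulr_gt0.
have iw2 : intg (fun x => w x ^+ 2) by exact: (@intg_pow _ _ B).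
pose p z := \int[mu]_x (`|w x| * `|w (x + z)|).
have ip z : intg (fun x => `|w x| * `|w (x + z)|).
  apply: (@intg_bounded _ _ _ B); first exact: intg_norm.
    apply: measurableT_comp => //; exact: intg_measurable (intg_shiftD iw z).
  by move=> x; rewrite normr_id.
have p0 z : 0 <= p z by apply: Rintegral_ge0 => x _; rewrite mulr_ge0.
have pt z : z \in `[0, L] -> I2 <= 2 * p z + 4 * (a * k.+1%:R ^+ 2 * D).
  rewrite in_itv/= => /andP[z0 zL].
  have om : modulus w z <= a * k.+1%:R ^+ 2 * D.
    have := modulus_scale iw wB k (z / k.+1%:R); rewrite mulrCA mulfV ?gt_eqF// mulr1.
    move=> h; apply: le_trans h _.
    rewrite (_ : a * k.+1%:R ^+ 2 * D = k.+1%:R ^+ 2 * (a * D)); last by ring.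
    rewrite ler_wpM2l ?sqr_ge0//; apply: (mod_le w B iw wB).
    by rewrite ger0_norm ?divr_ge0// ler_pdivrMr// mulrC.
  apply: le_trans (_ : 2 * p z + 4 * modulus w z <= _); last first.
    by rewrite lerD2l ler_wpM2l.
  have im := intg_modulus iw wB z 0.
  have -> : modulus w z = \int[mu]_x (w (x + z) - w (x + 0)) ^+ 2.
    by rewrite (modulusE iw) subr0.
  rewrite /p -!RintegralZl// -RintegralD//; try exact: intgZl.
  apply: le_Rintegral => //; first by apply: intgD; exact: intgZl.
  move=> x _; rewrite addr0; move: (w x) (w (x + z)) => r s.
  rewrite -(real_normK (num_real r)) -(real_normK (num_real (s - r))).
  have h1 : `|r| - `|s| <= `|s - r| by rewrite distrC lerB_dist.
  (* either [|r| <= 2 |s|], and [r^2 <= 2 |r| |s|], or [|r| <= 2 |s - r|] *)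
  have [rs|rs] := lerP `|r| (2 * `|s|); have s0 := normr_ge0 s; have r0 := normr_ge0 r.
    have h2 : 0 <= `|r| * (2 * `|s| - `|r|) by rewrite mulr_ge0// subr_ge0.
    by have h3 := sqr_ge0 `|s - r|; rewrite expr2 in h3 *; lra.
  have h2 : `|r| ^+ 2 <= (2 * `|s - r|) ^+ 2 by rewrite lerXn2r ?nnegrE ?mulr_ge0//; lra.
  have h3 : 0 <= `|r| * `|s| by rewrite mulr_ge0.
  by rewrite exprMn in h2; lra.
have pint : (\int[mu]_z (p z)%:E = (I1 ^+ 2)%:E)%E.
  have pE z : ((p z)%:E = \int[mu]_x (`|w x| * `|w (x + z)|)%:E)%E.
    by rewrite intg_fineK.
  under eq_integral do rewrite pE.
  have mww : measurable_fun setT (fun q : R * R => (`|w q.2| * `|w (q.2 + q.1)|)%:E).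
    apply/measurable_EFinP; apply: measurable_funM; apply: measurableT_comp => //.
      by apply: (measurableT_comp mw); exact: measurable_snd.
    exact: measurable_shifted.
  rewrite (@tonelli_swap _ (fun z x => (`|w x| * `|w (x + z)|)%:E) mww); last first.
    by move=> x y; rewrite lee_fin mulr_ge0.
  have mwn : measurable_fun setT (fun x => (`|w x|)%:E).
    by apply/measurable_EFinP; exact: measurableT_comp.
  transitivity (\int[mu]_x ((`|w x|)%:E * I1%:E))%E.
    apply: eq_integral => x _.
    rewrite /I1 intg_fineK; last exact: intg_norm.
    rewrite -(@ge0_integral_shift _ (fun z : R => (`|w z|)%:E) x)// -ge0_integralZl//.
    - by apply: eq_integral => z _; rewrite -EFinM addrC.
    - apply/measurable_EFinP; apply: measurableT_comp => //.
      exact: intg_measurable (intg_shiftD iw x).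
  rewrite ge0_integralZr// -intg_fineK; last exact: intg_norm.
  by rewrite -EFinM expr2.
have mp : measurable_fun setT p.
  apply/measurable_EFinP.
  rewrite (_ : _ \o _ = fun z => \int[mu]_x (`|w x| * `|w (x + z)|)%:E)%E; last first.
    by apply/funext => z; rewrite /= intg_fineK.
  apply: (@measurable_tonelli _ (fun z x => (`|w x| * `|w (x + z)|)%:E)).
    apply/measurable_EFinP; apply: measurable_funM; apply: measurableT_comp => //.
      by apply: (measurableT_comp mw); exact: measurable_snd.
    exact: measurable_shifted.
  by move=> x y; rewrite lee_fin mulr_ge0.
have muI : mu `[0, L]%classic = L%:E.
  by rewrite lebesgue_measure_itv/= lte_fin L0 -EFinD subr0.
set c := 4 * (a * k.+1%:R ^+ 2 * D).
have c0 : 0 <= c by rewrite !mulr_ge0// ?sqr_ge0// ltW.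
have : (I2%:E * L%:E <= 2%:E * (I1 ^+ 2)%:E + c%:E * L%:E)%E.
  rewrite -muI -!integral_cst// -pint -ge0_integralZl//; last 2 first.
  - exact/measurable_EFinP.
  - by move=> z _; rewrite lee_fin.
  apply: (@le_trans _ _ (\int[mu]_(z in `[0%R, L]%classic) (2%:E * (p z)%:E + cst c%:E z))%E).
    apply: ge0_le_integral => //.
    - by move=> z _; rewrite lee_fin Rintegral_ge0// => x _; exact: sqr_ge0.
    - apply: emeasurable_funD => //; apply: measurable_funeM; apply/measurable_EFinP.
      exact: measurable_funTS.
  rewrite ge0_integralD//; last 2 first.
  - by move=> z _; rewrite -EFinM lee_fin mulr_ge0.
  - by apply: measurable_funeM; apply/measurable_EFinP; exact: measurable_funTS.
  rewrite leeD2r//; apply: ge0_subset_integral => //.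
  - by apply: measurable_funeM; exact/measurable_EFinP.
  - by move=> z _; rewrite -EFinM lee_fin mulr_ge0.
rewrite -!EFinM -EFinD lee_fin => h.
have {}h : I2 <= 2 * I1 ^+ 2 / L + c by rewrite -ler_pdivlMr// mulrDl mulfK ?gt_eqF// in h.
apply: le_trans h _.
have q1 : 0 <= I1 ^+ 2 / k.+1%:R by rewrite divr_ge0// sqr_ge0.
have q2 : 0 <= k.+1%:R ^+ 2 * D by rewrite mulr_ge0// sqr_ge0.
have -> : 2 * I1 ^+ 2 / L = 2 / d * (I1 ^+ 2 / k.+1%:R).
  by rewrite /L; field; rewrite !gt_eqF.
have -> : c = 4 * a * (k.+1%:R ^+ 2 * D) by rewrite /c; ring.
move: (I1 ^+ 2 / _) (_ ^+ 2 * D) q1 q2 => X Y X0 Y0.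
have d1 : 0 <= 2 / d by rewrite divr_ge0// ltW.
rewrite -subr_ge0 (_ : _ - _ = 2 / d * Y + 4 * a * X); last by ring.
apply: addr_ge0; first exact: mulr_ge0.
by apply: mulr_ge0 => //; apply: mulr_ge0 => //; exact: ltW.
Qed.

End nash.

(** * Barrier argument and elementary estimates *)

Section barrier.
Context {R : realType}.
Implicit Types d : R -> R.

Definition continuous_from0 d := forall t e : R, 0 <= t -> 0 < e ->
  exists2 r, 0 < r & forall s, 0 <= s -> `|s - t| < r -> `|d s - d t| <= e.

(** Comparison for functions that need not be differentiable: past the last time
up to which [d <= 0], either continuity (if [d] is negative there) or the contact
hypothesis (if [d] vanishes) prolongs the inequality. *)
Lemma barrier d (T : R) : continuous_from0 d -> d 0 < 0 ->
  (forall t, 0 < t -> t < T -> d t = 0 ->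
    exists2 r, 0 < r & forall h, 0 < h -> h < r -> d (t + h) <= 0) ->
  forall t, 0 <= t <= T -> d t <= 0.
Proof.
move=> dc d0 contact t /andP[t0 tT]; rewrite leNgt; apply/negP => dt.
pose S := [set s : R | 0 <= s <= t /\ forall r, 0 <= r <= s -> d r <= 0].
have S0 : S 0.
  split; first by rewrite lexx.
  by move=> r /andP[r0 r0']; rewrite (le_anti (introT andP (conj r0' r0))) ltW.
have Sub : has_sup S.
  by split; [exists 0|exists t => s [/andP[]]].
set s := sup S.
have s0 : 0 <= s by apply: ub_le_sup => //; exact: Sub.2.
have st : s <= t by apply: ge_sup; [exists 0|move=> r [/andP[]]].
have below r : 0 <= r -> r < s -> d r <= 0.
  move=> r0 rs.
  have rs' : 0 < s - r by rewrite subr_gt0.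
  have [e Se] := sup_adherent rs' Sub.
  rewrite -/s subKr => re.
  by apply: Se.2; rewrite r0 ltW.
have ds : d s <= 0.
  rewrite leNgt; apply/negP => ds.
  have [r r0 rP] := dc s (d s / 2) s0 (divr_gt0 ds (ltr0Sn R 1)).
  have s_pos : 0 < s.
    by rewrite lt_neqAle s0 andbT; apply/negP => /eqP e; rewrite -e in ds; lra.
  pose s' := Num.max 0 (s - r / 2).
  have s'0 : 0 <= s' by rewrite /s' le_max lexx.
  have s's : s' < s by rewrite /s' gt_max s_pos/= ltrBlDr ltrDl divr_gt0.
  have s'r : `|s' - s| < r.
    rewrite distrC ger0_norm ?subr_ge0 ?(ltW s's)//.
    rewrite ltrBlDr -ltrBlDl /s' lt_max; apply/orP; right; lra.
  have := rP s' s'0 s'r; have := below s' s'0 s's.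
  by rewrite ler_norml => ? /andP[]; lra.
have le_s r : 0 <= r <= s -> d r <= 0.
  by move=> /andP[r0]; rewrite le_eqVlt => /predU1P[->//|]; exact: below.
have s_lt_t : s < t.
  by rewrite lt_neqAle st andbT; apply/negP => /eqP e; rewrite e in ds; lra.
have [r r0 rP] : exists2 r, 0 < r & forall h, 0 < h -> h < r -> d (s + h) <= 0.
  have [ds0|ds0] := eqVneq (d s) 0.
    apply: contact => //; last exact: lt_le_trans tT.
    by rewrite lt_neqAle s0 andbT; apply/negP => /eqP e; rewrite -e in ds0; lra.
  have ds' : 0 < - d s by rewrite oppr_gt0 lt_neqAle ds0.
  have [r r0 rP] := dc s (- d s) s0 ds'.
  exists r => // h h0 hr; have := rP (s + h) (addr_ge0 s0 (ltW h0)).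
  rewrite (_ : s + h - s = h); last by ring.
  rewrite (ger0_norm (ltW h0)).
  by move=> /(_ hr); rewrite ler_norml => /andP[]; lra.
pose h := Num.min (r / 2) (t - s).
have h0 : 0 < h by rewrite lt_min divr_gt0// subr_gt0.
have hr : h < r by rewrite gt_min; apply/orP; left; lra.
have ht : s + h <= t by rewrite -lerBrDl ge_min lexx orbT.
have : S (s + h).
  split; first by rewrite ht addr_ge0// ltW.
  move=> x /andP[x0 xh]; have [xs|sx] := lerP x s; first by apply: le_s; rewrite x0.
  have -> : x = s + (x - s) by rewrite subrKC.
  by apply: rP; lra.
move=> /(ub_le_sup Sub.2); rewrite -/s; lra.
Qed.

End barrier.

Section scalar_estimates.
Context {R : realType}.
Implicit Types x v M : R.

Lemma power_taylor k M : 0 <= M -> exists2 c, 0 <= c &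
  forall x v, `|x| <= M -> `|v| <= M ->
    `|x ^+ k.+1 - v ^+ k.+1 - k.+1%:R * v ^+ k * (x - v)| <= c * (x - v) ^+ 2.
Proof.
move=> M0; elim: k => [|k [c c0 IH]].
  exists 0 => // x v _ _.
  by rewrite !expr1 expr0 !mul1r subrr normr0 mul0r.
exists (M * c + k.+1%:R * M ^+ k).
  by rewrite addr_ge0 ?mulr_ge0// exprn_ge0.
move=> x v xM vM.
have -> : x ^+ k.+2 - v ^+ k.+2 - k.+2%:R * v ^+ k.+1 * (x - v) =
  x * (x ^+ k.+1 - v ^+ k.+1 - k.+1%:R * v ^+ k * (x - v)) +
  k.+1%:R * v ^+ k * (x - v) ^+ 2.
  have -> : k.+2%:R = k.+1%:R + 1 :> R by rewrite -[k.+2]addn1 natrD.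
  by rewrite (exprS x k.+1) (exprS v k.+1) (exprS v k); ring.
rewrite (le_trans (ler_normD _ _))// mulrDl lerD//.
  by rewrite normrM -[M * c * _]mulrA; apply: ler_pM => //; exact: IH.
rewrite 2!normrM (ger0_norm (sqr_ge0 _)) ler_wpM2r ?sqr_ge0//.
rewrite ger0_norm// ler_wpM2l// normrX lerXn2r// ?nnegrE//.
Qed.

Lemma power_lipschitz k M : 0 <= M -> exists2 L, 0 <= L &
  forall x v, `|x| <= M -> `|v| <= M -> `|x ^+ k.+1 - v ^+ k.+1| <= L * `|x - v|.
Proof.
move=> M0; elim: k => [|k [L L0 IH]].
  by exists 1 => // x v _ _; rewrite !expr1 mul1r.
exists (M * L + M ^+ k.+1); first by rewrite addr_ge0 ?mulr_ge0// exprn_ge0.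
move=> x v xM vM.
have -> : x ^+ k.+2 - v ^+ k.+2 = x * (x ^+ k.+1 - v ^+ k.+1) + v ^+ k.+1 * (x - v).
  by rewrite (exprS x k.+1) (exprS v k.+1); ring.
rewrite (le_trans (ler_normD _ _))// mulrDl lerD//.
  by rewrite normrM -[M * L * _]mulrA; apply: ler_pM => //; exact: IH.
by rewrite normrM ler_wpM2r// normrX lerXn2r// ?nnegrE.
Qed.

Lemma bernoulli_le n x : 0 <= x <= 1 -> 1 - n%:R * x <= (1 - x) ^+ n.
Proof.
move=> /andP[x0 x1]; elim: n => [|n IH]; first by rewrite mul0r subr0 expr0.
rewrite exprS; apply: le_trans (ler_wpM2l _ IH); last by rewrite subr_ge0.
have : 0 <= n%:R * x * x by rewrite !mulr_ge0.
by rewrite -[n.+1]addn1 natrD; lra.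
Qed.

(** Below the height [l] the linear term dominates, above it the higher power. *)
Lemma power_interpolation n l x : 0 < l ->
  `|x| ^+ n.+1 <= l ^+ n * `|x| + l ^- n.+1 * `|x| ^+ n.+1.*2.
Proof.
move=> l0; have X0 := normr_ge0 x; have [xl|lx] := lerP `|x| l.
  rewrite -[leLHS]addr0 lerD//.
    by rewrite exprSr ler_wpM2r// lerXn2r// nnegrE ltW.
  by rewrite mulr_ge0// ?invr_ge0 exprn_ge0// ltW.
rewrite -[leLHS]add0r lerD//; first by rewrite mulr_ge0// exprn_ge0// ltW.
rewrite mulrC ler_pdivlMr ?exprn_gt0// -addnn exprD ler_wpM2l ?exprn_ge0//.
by rewrite lerXn2r// ?nnegrE ltW.
Qed.

Lemma powR_interpolation q (p l x : R) : 1 <= p <= q%:R -> 0 < l ->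
  `|x| `^ p <= l `^ (p - 1) * `|x| + l `^ (p - q%:R) * `|x| ^+ q.
Proof.
move=> /andP[p1 pq] l0; have X0 := normr_ge0 x.
have A0 : 0 <= l `^ (p - 1) * `|x| by rewrite mulr_ge0// powR_ge0.
have B0 : 0 <= l `^ (p - q%:R) * `|x| ^+ q by rewrite mulr_ge0 ?powR_ge0 ?exprn_ge0.
have [xl|lx] := lerP `|x| l.
  apply: le_trans (_ : l `^ (p - 1) * `|x| <= _); last by rewrite lerDl.
  rewrite -mulr_powRB1//; last exact: lt_le_trans p1.
  rewrite mulrC ler_wpM2r//.
  by apply: ge0_ler_powR; rewrite ?nnegrE ?subr_ge0 ?(ltW l0).
apply: le_trans (_ : l `^ (p - q%:R) * `|x| ^+ q <= _); last by rewrite lerDr.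
have x0 : 0 < `|x| by exact: lt_trans lx.
have -> : `|x| `^ p = `|x| `^ (p - q%:R) * `|x| ^+ q.
  by rewrite -powR_mulrn// -powRD ?subrK// (gt_eqF x0) implybT.
rewrite ler_wpM2r ?exprn_ge0//.
rewrite -[p - q%:R]opprB !powRN lef_pV2 ?posrE ?powR_gt0//.
by apply: ge0_ler_powR; rewrite ?nnegrE ?subr_ge0 ?(ltW l0) ?(ltW lx).
Qed.

End scalar_estimates.

(** * Norms and representatives *)

Section norms.
Context {R : realType}.
Local Notation mu := (@lebesgue_measure R).
Local Notation intg f := (mu.-integrable setT (EFin \o f)).
Implicit Types f v : R -> R.

Lemma lebesgue_setT_gt0 : (0 < mu [set: R])%E.
Proof.
have h : (mu `[0%R, 1%R]%classic <= mu [set: R])%E.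
  by apply: le_measure; rewrite ?inE//; exact: measurable_itv.
by apply: lt_le_trans h; rewrite lebesgue_measure_itv/= lte_fin ltr01 sube0 lte_fin.
Qed.

Lemma LpNorm1E f : intg f -> LpNorm 1 f = (\int[mu]_x `|f x|)%:E.
Proof.
move=> fi; rewrite /LpNorm Lnorm1 intg_fineK; last exact: intg_norm.
by apply: eq_integral.
Qed.

Lemma LpNormooP f (M : R) :
  (LpNorm +oo f <= M%:E)%E <-> {ae mu, forall x, `|f x| <= M}.
Proof.
rewrite /LpNorm unlock lebesgue_setT_gt0; split.
  by move=> /ess_supP; apply: ae_imply => x /=; rewrite lee_fin.
by move=> h; apply/ess_supP; apply: ae_imply h => x /=; rewrite lee_fin.
Qed.

Lemma in_L1Loo_intg f : in_L1Loo f -> intg f.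
Proof. by move=> [/Lfun1_integrable]. Qed.

Lemma in_L1Loo_fin f : in_L1Loo f -> LpNorm +oo f = (fine (LpNorm +oo f))%:E.
Proof.
move=> [_ /sub_Lfun_finLfun]; rewrite inE /finite_norm => h.
rewrite fineK// ge0_fin_numE//; exact: Lnorm_ge0.
Qed.

Lemma in_L1Loo_bound f : in_L1Loo f -> {ae mu, forall x, `|f x| <= fine (LpNorm +oo f)}.
Proof. by move=> /in_L1Loo_fin h; apply/LpNormooP; rewrite -h. Qed.

Lemma L1Loo_norm_lt f (e : R) : measurable_fun setT f -> (L1Loo_norm f < e%:E)%E ->
  [/\ intg f, \int[mu]_x `|f x| <= e & {ae mu, forall x, `|f x| <= e}].
Proof.
move=> mf h.
have n1 : (0 <= LpNorm 1 f)%E by exact: Lnorm_ge0.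
have n2 : (0 <= LpNorm +oo f)%E by exact: Lnorm_ge0.
have h1 : (LpNorm 1 f < e%:E)%E by apply: le_lt_trans h; rewrite leeDl.
have h2 : (LpNorm +oo f < e%:E)%E by apply: le_lt_trans h; rewrite leeDr.
have fi : intg f.
  apply/integrableP; split; first exact/measurable_EFinP.
  by move: h1; rewrite /LpNorm Lnorm1 => /lt_trans; apply; rewrite ltry.
split => //; first by move: h1; rewrite LpNorm1E// lte_fin => /ltW.
exact/LpNormooP/ltW.
Qed.

(** Elements of L^oo are bounded almost everywhere only; this truncation is a
representative that is bounded everywhere. *)
Definition clamp (M : R) v (x : R) : R := Num.max (- M) (Num.min M (v x)).

Lemma clamp_measurable M v : measurable_fun setT v -> measurable_fun setT (clamp M v).
Proof. by move=> mv; apply: measurable_maxr => //; exact: measurable_minr. Qed.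

Lemma clamp_bounded M v x : 0 <= M -> `|clamp M v x| <= M.
Proof.
move=> M0; rewrite /clamp ler_norml le_max lexx/= ge_max ge_min lexx/= andbT.
by lra.
Qed.

Lemma clamp_id M v x : `|v x| <= M -> clamp M v x = v x.
Proof. by rewrite ler_norml /clamp => /andP[h1 h2]; rewrite min_r// max_r. Qed.

Lemma clamp_intg M v : 0 <= M -> intg v -> intg (clamp M v).
Proof.
move=> M0 iv; apply: (intg_dominated _ _ (intg_norm iv)).
  by apply: clamp_measurable; exact: intg_measurable.
move=> x; have [vM|Mv] := lerP `|v x| M; first by rewrite clamp_id.
by apply: le_trans (ltW Mv); exact: clamp_bounded.
Qed.

Lemma measurable_Rintegral (H : R -> R -> R) :
  measurable_fun setT (fun p : R * R => H p.1 p.2) ->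
  measurable_fun setT (fun x => \int[mu]_y H x y).
Proof.
move=> mH; rewrite /Rintegral.
have mE : measurable_fun setT (fun p : R * R => (H p.1 p.2)%:E) by exact/measurable_EFinP.
apply: (measurableT_comp (@fine_measurable R setT measurableT)).
rewrite (_ : (fun x => _) = fun x => (\int[mu]_y maxe (H x y)%:E 0 -
   \int[mu]_y maxe (- (H x y)%:E) 0)%E); last first.
  apply/funext => x; rewrite integralE; congr (_ - _)%E.
    by apply: eq_integral => y _; rewrite !funeposE.
  by apply: eq_integral => y _; rewrite !funenegE.
apply: emeasurable_funB.
  apply: (@measurable_tonelli _ (fun x y => maxe (H x y)%:E 0)%E).
    exact: measurable_maxe.
  by move=> x y; rewrite le_max lexx orbT.
apply: (@measurable_tonelli _ (fun x y => maxe (- (H x y)%:E) 0)%E).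
  by apply: measurable_maxe => //; exact: measurableT_comp.
by move=> x y; rewrite le_max lexx orbT.
Qed.

End norms.

Section representatives.
Context {R : realType} {K G : R -> R} {C : R}.
Hypothesis hKG : admissible_kernels K G C.
Local Notation mu := (@lebesgue_measure R).
Local Notation intg f := (mu.-integrable setT (EFin \o f)).

Lemma measurable_nonlocal_rhs (v : R -> R) : measurable_fun setT v ->
  measurable_fun setT (nonlocal_rhs K G v).
Proof.
move=> mv.
have m1 : measurable_fun setT (fun p : R * R => v p.1).
  by apply: (measurableT_comp mv); exact: measurable_fst.
have m2 : measurable_fun setT (fun p : R * R => v p.2).
  by apply: (measurableT_comp mv); exact: measurable_snd.
apply: measurable_funD; apply: measurable_Rintegral; apply: measurable_funM.
- exact: measurable_conv_kernel (intg_measurable (kernelK_intg hKG)).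
- exact: measurable_funB.
- exact: measurable_conv_kernel (intg_measurable (kernelG_intg hKG)).
- by apply: measurable_funX; apply: measurable_funM => //; exact: measurable_funD.
Qed.

(** The conclusion is only almost everywhere, as the right-hand side at [x] depends
on the value at [x] itself and not just on the integrals. *)
Lemma ae_eq_nonlocal_rhs (v w : R -> R) : measurable_fun setT v ->
  measurable_fun setT w -> {ae mu, forall x, v x = w x} ->
  {ae mu, forall x, nonlocal_rhs K G v x = nonlocal_rhs K G w x}.
Proof.
move=> mv mw vw; apply: ae_imply (vw) => x vwx.
have mK := intg_measurable (kernelK_slice hKG x).
have mG := intg_measurable (kernelG_slice hKG x).
rewrite /nonlocal_rhs; congr (_ + _); apply: ae_eq_Rintegral.
- by apply: measurable_funM => //; exact: measurable_funB.
- by apply: measurable_funM => //; exact: measurable_funB.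
- by apply: ae_imply vw => y ->; rewrite vwx.
- by apply: measurable_funM => //; apply: measurable_funX; apply: measurable_funM => //;
    exact: measurable_funD.
- by apply: measurable_funM => //; apply: measurable_funX; apply: measurable_funM => //;
    exact: measurable_funD.
- by apply: ae_imply vw => y ->; rewrite vwx.
Qed.

End representatives.

(** * Bounds on the solution *)

Section solution.
Context {R : realType} {K G : R -> R} {C : R}.
Hypothesis hKG : admissible_kernels K G C.
Local Notation mu := (@lebesgue_measure R).
Local Notation intg f := (mu.-integrable setT (EFin \o f)).
Context {phi : R -> R} {u : R -> R -> R}.
Hypothesis hphi : in_L1Loo phi.
Hypothesis hu : global_solution K G phi u.

Lemma solution_intg t : 0 <= t -> intg (u t).
Proof. by move=> t0; exact: in_L1Loo_intg (solution_L1Loo hu t0). Qed.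

Lemma solution_near t (e : R) : 0 <= t -> 0 < e ->
  exists2 r, 0 < r & forall s, 0 <= s -> `|s - t| < r ->
    \int[mu]_x `|u s x - u t x| <= e /\ {ae mu, forall x, `|u s x - u t x| <= e}.
Proof.
move=> t0 e0; have e0' : (0 < e%:E)%E by rewrite lte_fin.
have := solution_continuous hu t0 (open_ereal_lt' e0').
move=> /nbhs_ballP[r /= r0 rP]; exists r => // s s0 sr.
have /= := rP s; rewrite /ball/= distrC => /(_ sr s0) h.
have iD := intgB (solution_intg s0) (solution_intg t0).
by have [] := L1Loo_norm_lt (intg_measurable iD) h.
Qed.

(** The equation at time [t], read as one explicit Euler step whose error per unit
of time is small in both norms. *)
Lemma solution_euler t (e M : R) : 0 < t -> 0 < e ->
  {ae mu, forall x, `|u t x| <= M} -> C * M <= 1 ->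
  exists2 r, 0 < r & forall h, 0 < h -> h < r ->
    exists g : R -> R, [/\ intg g, \int[mu]_x `|g x| <= e,
      {ae mu, forall x, `|g x| <= e} &
      {ae mu, forall x, u (t + h) x = clamp M (u t) x +
         h * nonlocal_rhs K G (clamp M (u t)) x + h * g x}].
Proof.
move=> t0 e0 uM CM; have e0' : (0 < e%:E)%E by rewrite lte_fin.
have := solution_equation hu t0 (open_ereal_lt' e0').
move=> /nbhs_ballP[r /= r0 rP]; exists r => // h h0 hr.
have /= := rP h; rewrite /ball/= sub0r normrN gtr0_norm// => /(_ hr).
move=> /(_ (lt0r_neq0 h0)) hh.
have iut := solution_intg (ltW t0).
have iuth := solution_intg (addr_ge0 (ltW t0) (ltW h0)).
have mut := intg_measurable iut; have muth := intg_measurable iuth.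
pose g x := (u (t + h) x - u t x) / h - nonlocal_rhs K G (u t) x.
have mg : measurable_fun setT g.
  apply: measurable_funB; last exact: (measurable_nonlocal_rhs hKG).
  by apply: measurable_funM => //; exact: measurable_funB.
have [ig g1 g2] := L1Loo_norm_lt mg hh.
exists g; split => //.
have cl : {ae mu, forall x, u t x = clamp M (u t) x}.
  by apply: ae_imply uM => x xM; rewrite clamp_id.
have mcl := clamp_measurable M mut.
have rhs := ae_eq_nonlocal_rhs hKG mut mcl cl.
apply: ae_imply2 cl rhs => x e1 e2; rewrite -e1 -e2 /g.
by field; rewrite gt_eqF.
Qed.

Lemma ae_bound_ge0 (f : R -> R) (M : R) : {ae mu, forall x, `|f x| <= M} -> 0 <= M.
Proof.
move=> fM; have FP := @ae_properfilter_algebraOfSetsType _ _ _ mu lebesgue_setT_gt0.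
have [x xM] := @filter_ex _ _ FP _ fM.
exact: le_trans (normr_ge0 _) xM.
Qed.

Lemma esssup_le (f : R -> R) (M : R) : in_L1Loo f ->
  {ae mu, forall x, `|f x| <= M} -> fine (LpNorm +oo f) <= M.
Proof. by move=> hf /LpNormooP; rewrite (in_L1Loo_fin hf) lee_fin. Qed.

Let esssup t := fine (LpNorm +oo (u t)).

Let u_esssup t : 0 <= t -> {ae mu, forall x, `|u t x| <= esssup t}.
Proof. by move=> t0; exact/in_L1Loo_bound/(solution_L1Loo hu). Qed.

Lemma esssup_continuous : continuous_from0 esssup.
Proof.
move=> t e t0 e0; have [r r0 rP] := solution_near t0 e0.
exists r => // s s0 sr; have [_ h] := rP s s0 sr.
have le1 : esssup t <= esssup s + e.
  apply: (esssup_le (solution_L1Loo hu t0)).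
  apply: ae_imply2 (u_esssup s0) h => x h1 h2.
  by have := ler_normB (u s x) (u s x - u t x); rewrite subKr; lra.
have le2 : esssup s <= esssup t + e.
  apply: (esssup_le (solution_L1Loo hu s0)).
  apply: ae_imply2 (u_esssup t0) h => x h1 h2.
  by have := ler_normD (u s x - u t x) (u t x); rewrite subrK; lra.
by rewrite ler_norml; apply/andP; split; lra.
Qed.

Lemma continuous_from0B (d b : R -> R) : continuous_from0 d -> continuous_from0 b ->
  continuous_from0 (fun t => d t - b t).
Proof.
move=> dc bc t e t0 e0; have e2 : 0 < e / 2 by rewrite divr_gt0.
have [r1 r10 P1] := dc t _ t0 e2; have [r2 r20 P2] := bc t _ t0 e2.
exists (Num.min r1 r2); first by rewrite lt_min r10.
move=> s s0; rewrite lt_min => /andP[s1 s2].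
have h1 := P1 s s0 s1; have h2 := P2 s s0 s2.
rewrite (_ : _ - _ = (d s - d t) - (b s - b t)); last by ring.
by rewrite (le_trans (ler_normB _ _))//; lra.
Qed.

Lemma continuous_from0_affine (a c : R) : 0 <= c ->
  continuous_from0 (fun t => a + c * (1 + t)).
Proof.
move=> c0 t e t0 e0; exists (e / (c + 1)); first by rewrite divr_gt0// ltr_wpDl.
move=> s s0; rewrite ltr_pdivlMr ?ltr_wpDl// => h.
rewrite (_ : _ - _ = c * (s - t)); last by ring.
rewrite normrM ger0_norm//; have := normr_ge0 (s - t).
by move: h; set z := `|_|; lra.
Qed.

Lemma linear_eps_le (a b c : R) : 0 <= c -> (forall e, 0 < e -> e < 1 -> a <= b + e * c) -> a <= b.
Proof.
move=> c0 h; rewrite leNgt; apply/negP => ba.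
pose e := Num.min (1 / 2) ((a - b) / 2 / (c + 1)).
have c1 : 0 < c + 1 by rewrite ltr_wpDl.
have e0 : 0 < e by rewrite lt_min !divr_gt0// subr_gt0.
have e1 : e < 1 by rewrite gt_min; apply/orP; left; lra.
have e2 : e * (c + 1) <= (a - b) / 2 by rewrite -ler_pdivlMr// ge_min lexx orbT.
by have := h e e0 e1; lra.
Qed.

Local Notation M0 := (fine (LpNorm +oo phi)).
Local Notation m0 := (\int[mu]_x `|phi x|).

Lemma initial_esssup : esssup 0 = M0.
Proof.
apply/eqP; rewrite eq_le; apply/andP; split.
  apply: (esssup_le (solution_L1Loo hu (lexx _))).
  by apply: ae_imply2 (solution_initial hu) (in_L1Loo_bound hphi) => x ->.
apply: (esssup_le hphi).
by apply: ae_imply2 (solution_initial hu) (u_esssup (lexx _)) => x ->.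
Qed.

Hypothesis CM0 : C * M0 < 1.

(** Each Euler step keeps the bound, so the essential supremum cannot cross a
barrier [M0 + eps (1 + s)].  At a contact the step is taken at the level of the
barrier, and [eta] caps the slope [eps] so that this level satisfies the smallness
condition up to time [t]. *)
Lemma solution_maximum t : 0 <= t -> {ae mu, forall x, `|u t x| <= M0}.
Proof.
move=> t0; suff h : esssup t <= M0.
  by apply: ae_imply (u_esssup t0) => x h1; exact: le_trans h.
have C0 : 0 < C := kernel_const_gt0 hKG.
pose eta := (1 - C * M0) / (C * (1 + t)).
have eta0 : 0 < eta by rewrite divr_gt0 ?subr_gt0// mulr_gt0// ltr_wpDr.
apply: (@linear_eps_le _ _ (eta * (1 + t))).
  by rewrite mulr_ge0// ?addr_ge0// ltW.
move=> e e0 e1; pose eps := e * eta.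
have eps0 : 0 < eps by rewrite mulr_gt0.
pose b s := M0 + eps * (1 + s).
have dle : esssup t - b t <= 0.
  apply: (@barrier _ (fun s => esssup s - b s) t); last by rewrite t0 lexx.
  - apply: continuous_from0B; first exact: esssup_continuous.
    exact: continuous_from0_affine (ltW eps0).
  - by rewrite initial_esssup /b addr0 mulr1; lra.
  move=> s s0 st /eqP; rewrite subr_eq0 => /eqP es.
  have CM : C * esssup s <= 1.
    rewrite es /b mulrDr -lerBrDl; apply: le_trans (_ : C * (eta * (1 + t)) <= _).
      rewrite ler_wpM2l ?(ltW C0)// ler_pM ?(ltW eps0) ?addr_ge0 ?(ltW s0)//.
        by rewrite /eps ler_piMl ?ltW.
      by rewrite lerD2l ltW.
    rewrite /eta le_eqVlt; apply/orP; left; apply/eqP.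
    by field; rewrite !gt_eqF// ltr_wpDr.
  have us := u_esssup (ltW s0).
  have [r r0 rP] := solution_euler s0 eps0 us CM.
  exists (Num.min r (1 / 2)); first by rewrite lt_min r0 divr_gt0.
  move=> h h0; rewrite lt_min => /andP[hr h2].
  have [g [ig g1 g2 ueq]] := rP h h0 hr.
  rewrite subr_le0; apply: (esssup_le (solution_L1Loo hu (addr_ge0 (ltW s0) (ltW h0)))).
  apply: ae_imply2 g2 ueq => x gx ->.
  have M1 : 0 <= esssup s := ae_bound_ge0 us.
  have mcl := clamp_measurable (esssup s) (intg_measurable (solution_intg (ltW s0))).
  have hh : 0 <= h <= 1 / 2 by rewrite !ltW.
  have T := euler_step_bounded hKG x mcl (fun x => clamp_bounded (u s) x M1) CM hh.
  apply: le_trans (ler_normD _ _) _; rewrite normrM (gtr0_norm h0).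
  have : h * `|g x| <= h * eps by rewrite ler_wpM2l// ltW.
  by rewrite es /b in T *; lra.
by move: dle; rewrite subr_le0 /b /eps -(mulrA e eta).
Qed.

Lemma initial_L1 : \int[mu]_x `|u 0 x| = m0.
Proof.
apply: ae_eq_Rintegral.
- by apply: measurableT_comp => //; exact: intg_measurable (solution_intg (lexx _)).
- by apply: measurableT_comp => //; exact: intg_measurable (in_L1Loo_intg hphi).
- by apply: ae_imply (solution_initial hu) => x ->.
Qed.

Lemma L1_continuous : continuous_from0 (fun t => \int[mu]_x `|u t x|).
Proof.
move=> t e t0 e0; have [r r0 rP] := solution_near t0 e0.
exists r => // s s0 sr; have [h _] := rP s s0 sr; apply: le_trans h.
have is_ := intg_norm (solution_intg s0); have it := intg_norm (solution_intg t0).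
rewrite -RintegralB//; apply: le_trans (le_normr_Rintegral _ _) _ => //.
  exact: intgB.
apply: le_Rintegral => //.
- exact/intg_norm/intgB.
- by apply: intg_norm; apply: intgB; exact: solution_intg.
- by move=> x _; exact: ler_dist_dist.
Qed.

(** At a contact with [m0 + e (1 + s)], L^1 contraction of the Euler step leaves
only its error, which is within the slope [e] of the barrier. *)
Lemma solution_L1 t : 0 <= t -> \int[mu]_x `|u t x| <= m0.
Proof.
move=> t0; apply: (@linear_eps_le _ _ (1 + t)); first exact: addr_ge0.
move=> e e0 _; pose b s := m0 + e * (1 + s).
have : \int[mu]_x `|u t x| - b t <= 0; last by rewrite subr_le0.
apply: (@barrier _ (fun s => \int[mu]_x `|u s x| - b s) t); last by rewrite t0 lexx.
- apply: continuous_from0B; first exact: L1_continuous.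
  exact: continuous_from0_affine (ltW e0).
- by rewrite initial_L1 /b addr0 mulr1; lra.
move=> s s0 st /eqP; rewrite subr_eq0 => /eqP es.
have us := solution_maximum (ltW s0).
have M00 : 0 <= M0 := ae_bound_ge0 us.
have [r r0 rP] := solution_euler s0 e0 us (ltW CM0).
exists (Num.min r (1 / 2)); first by rewrite lt_min r0 divr_gt0.
move=> h h0; rewrite lt_min => /andP[hr h2].
have [g [ig g1 g2 ueq]] := rP h h0 hr.
have ius := solution_intg (ltW s0).
have hh : 0 <= h <= 1 / 2 by rewrite !ltW.
have icl := clamp_intg M00 ius.
have clM x := clamp_bounded (u s) x M00.
have iF := nonlocal_rhs_intg hKG icl clM (ltW CM0).
have T := euler_step_L1 hKG icl clM (ltW CM0) hh.
have iT : intg (fun x => clamp M0 (u s) x + h * nonlocal_rhs K G (clamp M0 (u s)) x).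
  by apply: intgD => //; exact: intgZl.
have ecl : \int[mu]_x `|clamp M0 (u s) x| = \int[mu]_x `|u s x|.
  apply: ae_eq_Rintegral.
  - by apply: measurableT_comp => //; exact: intg_measurable icl.
  - by apply: measurableT_comp => //; exact: intg_measurable ius.
  - by apply: ae_imply us => x xM; rewrite clamp_id.
have iuh := solution_intg (addr_ge0 (ltW s0) (ltW h0)).
have step : \int[mu]_x `|u (s + h) x| <=
    \int[mu]_x (`|clamp M0 (u s) x + h * nonlocal_rhs K G (clamp M0 (u s)) x| + h * `|g x|).
  apply: ae_le_Rintegral.
  - exact: intg_norm.
  - by apply: intgD; [exact: intg_norm|exact/intgZl/intg_norm].
  - apply: ae_imply ueq => x ->; apply: le_trans (ler_normD _ _) _.
    by rewrite [`|h * _|]normrM (gtr0_norm h0).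
rewrite RintegralD// in step; [|exact: intg_norm|exact/intgZl/intg_norm].
rewrite RintegralZl// in step; last exact: intg_norm.
have hg : h * \int[mu]_x `|g x| <= h * e by rewrite ler_wpM2l// ltW.
rewrite subr_le0 (le_trans step)//.
apply: le_trans (lerD T hg) _; rewrite ecl es /b; lra.
Qed.

End solution.

(** * The barrier function and the evolution of power masses *)

Section barrier_function.
Context {R : realType}.

Definition inv_sqrt (T0 t : R) : R := (Num.sqrt (T0 + t))^-1.

Lemma inv_sqrt_gt0 (T0 t : R) : 0 < T0 -> 0 <= t -> 0 < inv_sqrt T0 t.
Proof. by move=> T00 t0; rewrite invr_gt0 sqrtr_gt0 ltr_wpDr. Qed.

Lemma inv_sqrt_sqr (T0 t : R) : 0 < T0 -> 0 <= t -> inv_sqrt T0 t ^+ 2 = (T0 + t)^-1.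
Proof. by move=> T00 t0; rewrite exprVn sqr_sqrtr// addr_ge0// ltW. Qed.

Lemma inv_sqrt_le (T0 t h : R) : 0 < T0 -> 0 <= t -> 0 <= h ->
  inv_sqrt T0 (t + h) <= inv_sqrt T0 t.
Proof.
move=> T00 t0 h0; rewrite lef_pV2 ?posrE ?sqrtr_gt0 ?ltr_wpDr ?addr_ge0//.
by rewrite ler_wsqrtr// addrA lerDl.
Qed.

Lemma inv_sqrt_ge (T0 t h : R) : 0 < T0 -> 0 <= t -> 0 <= h ->
  inv_sqrt T0 t * (1 - h / (T0 + t)) <= inv_sqrt T0 (t + h).
Proof.
move=> T00 t0 h0; have a0 : 0 < T0 + t by rewrite ltr_wpDr.
have ah0 : 0 < T0 + (t + h) by rewrite ltr_wpDr// addr_ge0.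
set s := inv_sqrt T0 t; set s' := inv_sqrt T0 (t + h).
have s0 : 0 < s by exact: inv_sqrt_gt0.
have s'0 : 0 < s' by apply: inv_sqrt_gt0 => //; exact: addr_ge0.
have ss' : s' <= s by exact: inv_sqrt_le.
have e1 : s ^+ 2 = (T0 + t)^-1 by exact: inv_sqrt_sqr.
have e2 : s' ^+ 2 = (T0 + (t + h))^-1 by apply: inv_sqrt_sqr => //; exact: addr_ge0.
(* squares remove the roots, and [s' / s >= (s' / s)^2] as [s' <= s] *)
have h1 : s * (1 - h / (T0 + t)) <= s * (s' ^+ 2 / s ^+ 2).
  rewrite ler_wpM2l ?(ltW s0)// e1 e2 invrK [leRHS]mulrC ler_pdivlMr//.
  have -> : (1 - h / (T0 + t)) * (T0 + (t + h)) = (T0 + t) - h ^+ 2 / (T0 + t).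
    by field; rewrite gt_eqF.
  by rewrite gerBl divr_ge0 ?sqr_ge0// ltW.
apply: le_trans h1 _.
have -> : s * (s' ^+ 2 / s ^+ 2) = s' * (s' / s) by field; rewrite gt_eqF.
by rewrite ler_piMr ?(ltW s'0)// ler_pdivrMr// mul1r.
Qed.

Lemma inv_sqrt_power_ge k (T0 t h : R) : 0 < T0 -> 0 <= t -> 0 <= h -> h <= T0 + t ->
  inv_sqrt T0 t ^+ k * (1 - k%:R * (h / (T0 + t))) <= inv_sqrt T0 (t + h) ^+ k.
Proof.
move=> T00 t0 h0 ha; have a0 : 0 < T0 + t by rewrite ltr_wpDr.
have s0 : 0 < inv_sqrt T0 t by exact: inv_sqrt_gt0.
have x01 : 0 <= h / (T0 + t) <= 1.
  apply/andP; split; first by apply: divr_ge0 => //; exact: ltW.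
  by rewrite ler_pdivrMr// mul1r.
apply: le_trans (_ : inv_sqrt T0 t ^+ k * (1 - h / (T0 + t)) ^+ k <= _).
  by rewrite ler_wpM2l ?exprn_ge0 ?(ltW s0)// bernoulli_le.
rewrite -exprMn lerXn2r ?nnegrE//; last exact: inv_sqrt_ge.
  by rewrite mulr_ge0 ?(ltW s0)// subr_ge0; case/andP: x01.
by apply/ltW/inv_sqrt_gt0 => //; exact: addr_ge0.
Qed.

Lemma inv_sqrt_power_continuous k (c T0 : R) : 0 <= c -> 0 < T0 ->
  continuous_from0 (fun t => c * inv_sqrt T0 t ^+ k).
Proof.
move=> c0 T00.
pose b t := c * inv_sqrt T0 t ^+ k.
have lip t h : 0 <= t -> 0 <= h -> h <= T0 ->
    `|b (t + h) - b t| <= b 0 * (k%:R * (h / T0)).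
  move=> t0 h0 hT.
  have ha : h <= T0 + t by rewrite (le_trans hT)// lerDl.
  have a0 : 0 < T0 + t by rewrite ltr_wpDr.
  have g1 := inv_sqrt_power_ge k T00 t0 h0 ha.
  have g2 : inv_sqrt T0 (t + h) ^+ k <= inv_sqrt T0 t ^+ k.
    rewrite lerXn2r ?nnegrE//; last exact: inv_sqrt_le.
      by apply/ltW/inv_sqrt_gt0 => //; exact: addr_ge0.
    exact/ltW/inv_sqrt_gt0.
  have g3 : inv_sqrt T0 t ^+ k <= inv_sqrt T0 0 ^+ k.
    rewrite lerXn2r ?nnegrE//; try exact/ltW/inv_sqrt_gt0.
    by have := inv_sqrt_le T00 (lexx 0) t0; rewrite add0r.
  have s0 : 0 <= inv_sqrt T0 t ^+ k by exact/exprn_ge0/ltW/inv_sqrt_gt0.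
  rewrite /b -mulrBr normrM (ger0_norm c0) distrC ger0_norm ?subr_ge0// -mulrA.
  rewrite ler_wpM2l//.
  apply: le_trans (_ : inv_sqrt T0 t ^+ k * (k%:R * (h / (T0 + t))) <= _).
    by move: g1; rewrite mulrBr mulr1; lra.
  apply: ler_pM => //; first by rewrite mulr_ge0// divr_ge0// ltW.
  by rewrite ler_wpM2l// ler_wpM2l// lef_pV2 ?posrE// lerDl.
move=> t e t0 e0.
have b00 : 0 <= b 0 by rewrite mulr_ge0//; exact/exprn_ge0/ltW/inv_sqrt_gt0.
have d0 : 0 < b 0 * k%:R / T0 + 1 by rewrite ltr_wpDl// divr_ge0 ?(ltW T00)// mulr_ge0.
exists (Num.min T0 (e / (b 0 * k%:R / T0 + 1))); first by rewrite lt_min T00 divr_gt0.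
have bound h : 0 <= h -> h < e / (b 0 * k%:R / T0 + 1) -> b 0 * (k%:R * (h / T0)) <= e.
  move=> h0; rewrite ltr_pdivlMr// => he.
  have -> : b 0 * (k%:R * (h / T0)) = h * (b 0 * k%:R / T0) by ring.
  by lra.
move=> s s0; rewrite lt_min => /andP[sT se]; rewrite -/(b s) -/(b t).
have [ts|st] := lerP t s.
  have st0 : 0 <= s - t by rewrite subr_ge0.
  rewrite ger0_norm// in sT; rewrite ger0_norm// in se.
  have := lip t (s - t) t0 st0 (ltW sT); rewrite subrKC => h.
  exact: le_trans h (bound _ st0 se).
have ts0 : 0 <= t - s by rewrite subr_ge0 ltW.
rewrite distrC ger0_norm// in sT; rewrite distrC ger0_norm// in se.
have := lip s (t - s) s0 ts0 (ltW sT); rewrite subrKC distrC => h.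
exact: le_trans h (bound _ ts0 se).
Qed.

End barrier_function.

Lemma add_halves (R : realType) (a p q s d h e : R) :
  p <= - d -> q <= h * (e / 2) -> s <= h * (e / 2) -> a + p + q + s <= a - d + h * e.
Proof. by move=> *; lra. Qed.

Lemma taylor_euler (R : realType) (x v vk q h F g c A B : R) :
  x - v - q * vk * (h * (F + g)) <= c * (h * (F + g)) ^+ 2 ->
  q * vk * (h * g) <= A -> c * (h * (F + g)) ^+ 2 <= B ->
  x <= v + h * q * (vk * F) + A + B.
Proof. by move=> t a b; lra. Qed.

Section power_decay.
Context {R : realType} {K G : R -> R} {C : R}.
Hypothesis hKG : admissible_kernels K G C.
Local Notation mu := (@lebesgue_measure R).
Local Notation intg f := (mu.-integrable setT (EFin \o f)).
Context {phi : R -> R} {u : R -> R -> R}.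
Hypothesis hphi : in_L1Loo phi.
Hypothesis hu : global_solution K G phi u.
Local Notation M0 := (fine (LpNorm +oo phi)).
Local Notation m0 := (\int[mu]_x `|phi x|).
Hypothesis CM0 : C * M0 < 1.

Local Notation clu t := (clamp M0 (u t)).

Let uM (t : R) : 0 <= t -> {ae mu, forall x, `|u t x| <= M0}.
Proof. exact: (solution_maximum hKG hphi hu CM0). Qed.

Let M00 : 0 <= M0. Proof. exact: (ae_bound_ge0 (uM (lexx 0))). Qed.

Let cluM (t x : R) : `|clu t x| <= M0. Proof. exact: clamp_bounded. Qed.

Let iclu (t : R) : 0 <= t -> intg (clu t).
Proof. by move=> t0; apply: clamp_intg => //; exact: (solution_intg hu). Qed.

Let clE (t : R) : 0 <= t -> {ae mu, forall x, u t x = clu t x}.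
Proof. by move=> t0; apply: ae_imply (uM t0) => x xM; rewrite clamp_id. Qed.

Lemma L1_clamp (t : R) : 0 <= t -> \int[mu]_x `|clu t x| <= m0.
Proof.
move=> t0; rewrite -(@ae_eq_Rintegral _ (fun x => `|u t x|)).
- exact: (solution_L1 hKG hphi hu CM0).
- by apply: measurableT_comp => //; exact: intg_measurable (solution_intg hu t0).
- by apply: measurableT_comp => //; exact: intg_measurable (iclu t0).
- by apply: ae_imply (clE t0) => x ->.
Qed.

Definition power_mass m (t : R) : R := \int[mu]_x (clu t x ^+ m.*2.+2).

Let ipow k (t : R) : 0 <= t -> intg (fun x => clu t x ^+ k.+1).
Proof. by move=> t0; apply: (@intg_pow _ _ M0) => //; exact: iclu. Qed.

Lemma power_mass_continuous m : continuous_from0 (power_mass m).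
Proof.
have [L L0 Lip] := @power_lipschitz R m.*2.+1 M0 M00.
move=> t e t0 e0.
have L1 : 0 < L + 1 by rewrite ltr_wpDl.
have e' : 0 < e / (L + 1) by rewrite divr_gt0.
have [r r0 rP] := solution_near hu t0 e'; exists r => // s s0 sr.
have [h _] := rP s s0 sr.
rewrite /power_mass -RintegralB ?ipow//.
apply: le_trans (le_normr_Rintegral _ _) _ => //; first by apply: intgB; exact: ipow.
have iD : intg (fun x => clu s x - clu t x) by apply: intgB; exact: iclu.
apply: le_trans (_ : \int[mu]_x (L * `|clu s x - clu t x|) <= _).
  apply: le_Rintegral => //.
  - by apply: intg_norm; apply: intgB; exact: ipow.
  - exact/intgZl/intg_norm.
  - by move=> x _; exact: Lip.
rewrite RintegralZl//; last exact: intg_norm.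
rewrite (@ae_eq_Rintegral _ _ (fun x => `|u s x - u t x|)).
- have n0 : 0 <= \int[mu]_x `|u s x - u t x| by exact: Rintegral_ge0.
  move: (\int[mu]_x _) n0 h => I I0; rewrite ler_pdivlMr// => h.
  by rewrite mulrC; apply: le_trans h; rewrite ler_wpM2l// lerDl.
- by apply: measurableT_comp => //; exact: intg_measurable iD.
- apply: measurableT_comp => //; apply: measurable_funB;
    exact: intg_measurable (solution_intg hu _).
- by apply: ae_imply2 (clE s0) (clE t0) => x -> ->.
Qed.

(** Expand [s^q], [q = 2 m + 2], around the clamped solution along one Euler step:
the linear term is bounded by the energy inequality, while the step error and the
quadratic remainder are at most [h e / 2] each. *)
Lemma power_mass_step m (t e : R) : 0 < t -> 0 < e ->
  exists2 r, 0 < r & forall h, 0 < h -> h < r ->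
    power_mass m (t + h) <= power_mass m t -
      h * ((1 - C * M0) / 2 * dirichlet (K := K) (fun x => clu t x ^+ m.+1)) + h * e.
Proof.
move=> t_gt0 e0; have t0 := ltW t_gt0.
set v := clu t; pose F := nonlocal_rhs K G v.
have iv : intg v := iclu t0; have vM : forall x, `|v x| <= M0 := cluM t.
have mv := intg_measurable iv.
have iF : intg F := nonlocal_rhs_intg hKG iv vM (ltW CM0).
(* the step of size [1/2] moves between values in [[-M0, M0]] *)
have FM x : `|F x| <= 4 * M0.
  have hh : 0 <= (1 / 2 : R) <= 1 / 2. by apply/andP; split; [exact: divr_ge0|exact: lexx].
  have := euler_step_bounded hKG x mv vM (ltW CM0) hh; rewrite -/(F x).
  have := vM x; rewrite !ler_norml => /andP[? ?] /andP[? ?].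
  by apply/andP; split; lra.
have [c c0 tay] := @power_taylor R m.*2.+1 M0 M00.
pose q : R := m.*2.+2%:R.
have q0 : 0 <= q by [].
pose e1 := Num.min 1 (e / 2 / (q * M0 ^+ m.*2.+1 + 1)).
have qM : 0 <= q * M0 ^+ m.*2.+1 by rewrite mulr_ge0// exprn_ge0.
have e10 : 0 < e1 by rewrite lt_min ltr01 !divr_gt0// ltr_wpDl.
have e11 : e1 <= 1 by rewrite ge_min lexx.
have e1e : q * M0 ^+ m.*2.+1 * e1 <= e / 2.
  have : (q * M0 ^+ m.*2.+1 + 1) * e1 <= e / 2.
    by rewrite mulrC -ler_pdivlMr ?ltr_wpDl// ge_min lexx orbT.
  by lra.
have JF : 0 <= \int[mu]_x `|F x| by exact: Rintegral_ge0.
pose Z := c * ((4 * M0 + 1) * (\int[mu]_x `|F x| + 1)).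
have Z0 : 0 <= Z by rewrite !mulr_ge0// addr_ge0// mulr_ge0.
have [r r0 rP] := solution_euler hKG hu t_gt0 e10 (uM t0) (ltW CM0).
exists (Num.min r (e / 2 / (Z + 1))); first by rewrite lt_min r0 !divr_gt0// ltr_wpDl.
move=> h h0; rewrite lt_min => /andP[hr hZ].
have {}hZ : h * Z <= e / 2 by move: hZ; rewrite ltr_pdivlMr ?ltr_wpDl//; lra.
have [g [ig g1 g2 ueq]] := rP h h0 hr.
have th0 : 0 <= t + h by rewrite addr_ge0// ltW.
have ivF : intg (fun x => v x ^+ m.*2.+1 * F x).
  have -> : (fun x => v x ^+ m.*2.+1 * F x) = (fun x => F x * v x ^+ m.*2.+1).
    by apply/funext => x; rewrite mulrC.
  apply: (@intg_bounded _ _ _ (M0 ^+ m.*2.+1)) => //; first exact: measurable_funX.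
  by move=> x; rewrite normrX lerXn2r// nnegrE.
have i1 : intg (fun x => h * q * (v x ^+ m.*2.+1 * F x)) by exact: intgZl.
have i2 : intg (fun x => h * q * M0 ^+ m.*2.+1 * `|g x|) by exact/intgZl/intg_norm.
have i3 : intg (fun x => h * h * c * (4 * M0 + 1) * (`|F x| + `|g x|)).
  by apply/intgZl/intgD; exact: intg_norm.
have i12 := intgD (ipow m.*2.+1 t0) i1; have i123 := intgD i12 i2.
have i1234 := intgD i123 i3.
have step : power_mass m (t + h) <= \int[mu]_x (v x ^+ m.*2.+2 +
    h * q * (v x ^+ m.*2.+1 * F x) + h * q * M0 ^+ m.*2.+1 * `|g x| +
    h * h * c * (4 * M0 + 1) * (`|F x| + `|g x|)).
  apply: ae_le_Rintegral => //; first exact: ipow.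
  have ceq : {ae mu, forall x, clu (t + h) x = v x + h * F x + h * g x}.
    by apply: ae_imply2 ueq (clE th0) => x <- ->.
  apply: ae_imply2 g2 ceq => x gx eq.
  have := tay (clu (t + h) x) (v x) (cluM _ _) (vM x).
  have -> : clu (t + h) x - v x = h * (F x + g x) by rewrite eq; ring.
  move=> /(le_trans (ler_norm _)) T.
  have vg : q * v x ^+ m.*2.+1 * (h * g x) <= h * q * M0 ^+ m.*2.+1 * `|g x|.
    rewrite (_ : q * _ * _ = h * q * (v x ^+ m.*2.+1 * g x)); last by ring.
    rewrite -[leRHS]mulrA ler_wpM2l ?mulr_ge0// ?(ltW h0)//.
    rewrite (le_trans (ler_norm _))// normrM ler_wpM2r// normrX.
    by rewrite lerXn2r// nnegrE.
  have sq : (F x + g x) ^+ 2 <= (4 * M0 + 1) * (`|F x| + `|g x|).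
    rewrite -(real_normK (num_real _)) expr2 ler_pM//; last exact: ler_normD.
    by rewrite (le_trans (ler_normD _ _))// lerD// (le_trans gx).
  have sq' : c * (h * (F x + g x)) ^+ 2 <= h * h * c * (4 * M0 + 1) * (`|F x| + `|g x|).
    rewrite (_ : c * _ = h * h * c * (F x + g x) ^+ 2); last by ring.
    by rewrite -[leRHS]mulrA ler_wpM2l// !mulr_ge0// ltW.
  exact: taylor_euler T vg sq'.
rewrite RintegralD// RintegralD// RintegralD ?ipow// in step.
rewrite !RintegralZl// in step; try exact: intg_norm; last first.
  by apply/intgD; exact: intg_norm.
rewrite RintegralD// in step; try exact: intg_norm.
have en := energy_inequality hKG m iv vM (ltW CM0).
have {}en : h * q * \int[mu]_x (v x ^+ m.*2.+1 * F x) <=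
   - (h * ((1 - C * M0) / 2 * dirichlet (K := K) (fun x => v x ^+ m.+1))).
  apply: le_trans (ler_wpM2l (mulr_ge0 (ltW h0) q0) en) _.
  rewrite le_eqVlt; apply/orP; left; apply/eqP.
  have qq : m.+1.*2%:R != 0 :> R by [].
  rewrite -/q; rewrite -[m.+1.*2%:R]/q in qq *.
  by field.
apply: (le_trans step).
have hg : h * q * M0 ^+ m.*2.+1 * \int[mu]_x `|g x| <= h * (e / 2).
  rewrite -2!mulrA ler_wpM2l ?(ltW h0)// mulrA.
  by apply: le_trans e1e; rewrite ler_wpM2l.
have hF : h * h * c * (4 * M0 + 1) * (\int[mu]_x `|F x| + \int[mu]_x `|g x|) <= h * (e / 2).
  apply: le_trans (_ : h * (h * Z) <= _); last by rewrite ler_wpM2l// ltW.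
  rewrite (_ : h * (h * Z) = h * h * c * (4 * M0 + 1) * (\int[mu]_x `|F x| + 1)); last first.
    by rewrite /Z; ring.
  rewrite ler_wpM2l//; first by rewrite !mulr_ge0// ?(ltW h0)// addr_ge0// mulr_ge0.
  by rewrite lerD2l (le_trans g1).
exact: add_halves en hg hF.
Qed.

End power_decay.

(** * Decay of power masses *)

Section scale_selection.
Context {R : realType}.

(** At the scale [X = 8 A m' / l], rounded up, the L^1 term in Nash's inequality is
at most half of [E] and can be absorbed. *)
Lemma nash_scale (A D E W m' l : R) (m : nat) :
  0 < A -> 0 <= D -> 0 <= W -> 0 < m' -> 0 < l -> l <= 8 * A * m' ->
  (forall k : nat, E <= A * (k.+1%:R ^+ 2 * D + W ^+ 2 / k.+1%:R)) ->
  W <= 2 * m' * l ^+ m -> E = m' * l ^+ m.*2.+1 ->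
  E * l ^+ 2 <= 512 * A ^+ 3 * m' ^+ 2 * D.
Proof.
move=> A0 D0 W0 m'0 l0 lA nash WE EE.
pose X := 8 * A * m' / l.
have X1 : 1 <= X by rewrite ler_pdivlMr// mul1r.
have X0 : 0 < X by exact: lt_le_trans X1.
have /andP[tX Xt] := truncn_itv (ltW X0).
set k := Num.truncn X in tX Xt.
have kX : k.+1%:R <= 2 * X by rewrite -[k.+1]addn1 natrD; lra.
have W2 : W ^+ 2 / k.+1%:R <= (2 * m' * l ^+ m) ^+ 2 / X.
  apply: ler_pM; rewrite ?sqr_ge0 ?invr_ge0 ?ler0n//.
    by rewrite lerXn2r// nnegrE// (le_trans W0).
  by rewrite lef_pV2 ?posrE// ltW.
have W3 : (2 * m' * l ^+ m) ^+ 2 / X = E / (2 * A).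
  have e : l ^+ m.*2.+1 = l * (l ^+ m) ^+ 2 by rewrite exprS -exprM muln2.
  by rewrite EE e /X; field; rewrite !gt_eqF.
have k2 : k.+1%:R ^+ 2 * D <= (2 * X) ^+ 2 * D.
  by rewrite ler_wpM2r// lerXn2r// nnegrE// mulr_ge0// ltW.
have h : E <= A * ((2 * X) ^+ 2 * D + E / (2 * A)).
  apply: le_trans (nash k) _; rewrite ler_wpM2l ?(ltW A0)//.
  by apply: lerD => //; rewrite -W3.
have h2 : A * ((2 * X) ^+ 2 * D + E / (2 * A)) = 4 * A * X ^+ 2 * D + E / 2.
  by field; rewrite gt_eqF.
have {h2}{}h : E <= 8 * A * X ^+ 2 * D.
  by rewrite h2 in h; move: (X ^+ 2) h => Y h; lra.
have -> : 512 * A ^+ 3 * m' ^+ 2 * D = 8 * A * X ^+ 2 * D * l ^+ 2.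
  by rewrite /X; field; rewrite gt_eqF.
by rewrite ler_wpM2r ?sqr_ge0.
Qed.

(** Contact with the barrier, which loses at most the fraction [k h / a] of its value
over the time [h]: the dissipation takes away [k + 1] units [h y / a], one of
which pays for the error [e]. *)
Lemma barrier_step (y y' b' d e q h a k : R) : 0 < h ->
  y' <= y - h * d + h * e -> q * (y / a) <= d -> e <= y / a -> q = k + 1 ->
  y * (1 - k * (h / a)) <= b' -> y' <= b'.
Proof.
move=> h0 y1 d1 e1 qk b1; apply: le_trans y1 (le_trans _ b1).
have h1 := ler_wpM2l (ltW h0) d1; have h2 := ler_wpM2l (ltW h0) e1.
rewrite qk in h1.
have e3 : y * (1 - k * (h / a)) = y - h * ((k + 1) * (y / a)) + h * (y / a) by ring.
by rewrite e3; lra.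
Qed.

End scale_selection.

Section power_mass_decay.
Context {R : realType} {K G : R -> R} {C : R}.
Hypothesis hKG : admissible_kernels K G C.
Local Notation mu := (@lebesgue_measure R).
Local Notation intg f := (mu.-integrable setT (EFin \o f)).
Context {phi : R -> R} {u : R -> R -> R}.
Hypothesis hphi : in_L1Loo phi.
Hypothesis hu : global_solution K G phi u.
Local Notation M0 := (fine (LpNorm +oo phi)).
Local Notation m0 := (\int[mu]_x `|phi x|).
Local Notation clu t := (clamp M0 (u t)).
Hypothesis CM0 : C * M0 < 1.
Context {A : R}.
Hypothesis A0 : 0 < A.
Hypothesis nash : forall (w : R -> R) (B : R) (k : nat), intg w ->
  (forall x, `|w x| <= B) ->
  \int[mu]_x (w x ^+ 2) <=
    A * (k.+1%:R ^+ 2 * dirichlet (K := K) w + (\int[mu]_x `|w x|) ^+ 2 / k.+1%:R).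

Lemma initial_bound_ge0 : 0 <= M0.
Proof. exact: ae_bound_ge0 (in_L1Loo_bound hphi). Qed.

Let iclu (t : R) : 0 <= t -> intg (clu t).
Proof.
by move=> t0; apply: clamp_intg; [exact: initial_bound_ge0|exact: (solution_intg hu)].
Qed.

Let cluM (t x : R) : `|clu t x| <= M0.
Proof. exact/clamp_bounded/initial_bound_ge0. Qed.

(** When the power mass is [m' l^(q-1)] with [q = 2 m + 2], interpolation at the
height [l] bounds the L^1 norm of [u^(m+1)] by [2 m' l^m]. *)
Lemma dissipation_lower_bound (m : nat) (m' l t : R) : 0 <= t -> 0 < l -> m0 <= m' -> 0 < m' ->
  l <= 8 * A * m' -> power_mass (phi := phi) (u := u) m t = m' * l ^+ m.*2.+1 ->
  power_mass (phi := phi) (u := u) m t * l ^+ 2 <=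
  512 * A ^+ 3 * m' ^+ 2 * dirichlet (K := K) (fun x => clu t x ^+ m.+1).
Proof.
move=> t0 l0 mm m'0 lA EE.
have iw : intg (fun x => clu t x ^+ m.+1) by apply: (@intg_pow _ _ M0) => //; exact: iclu.
have wM x : `|clu t x ^+ m.+1| <= M0 ^+ m.+1.
  by rewrite normrX lerXn2r// ?nnegrE//; exact: initial_bound_ge0.
have W0 : 0 <= \int[mu]_x `|clu t x ^+ m.+1| by exact: Rintegral_ge0.
have EW : \int[mu]_x ((clu t x ^+ m.+1) ^+ 2) = power_mass (phi := phi) (u := u) m t.
  by apply: eq_Rintegral => x _; rewrite -exprM muln2.
apply: (nash_scale A0 (dirichlet_ge0 hKG _) W0 m'0 l0 lA _ _ EE).
  by move=> k; have := nash k iw wM; rewrite EW.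
have i1 : intg (fun x => l ^+ m * `|clu t x|) by apply/intgZl/intg_norm/iclu.
have iq : intg (fun x => clu t x ^+ m.*2.+2) by apply: (@intg_pow _ _ M0) => //; exact: iclu.
have i2 : intg (fun x => l ^- m.+1 * clu t x ^+ m.*2.+2) by exact: intgZl.
apply: le_trans (_ : \int[mu]_x (l ^+ m * `|clu t x| + l ^- m.+1 * clu t x ^+ m.*2.+2) <= _).
  apply: le_Rintegral => //; [exact: intg_norm|exact: intgD|].
  move=> x _; rewrite normrX; apply: le_trans (power_interpolation m (clu t x) l0) _.
  have even0 : 0 <= clu t x ^+ m.*2.+2 by rewrite -doubleS -muln2 exprM sqr_ge0.
  by rewrite doubleS -(normrX m.*2.+2 (clu t x)) (ger0_norm even0).
rewrite RintegralD// !RintegralZl//; last exact/intg_norm/iclu.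
rewrite -[X in _ + _ * X <= _]/(power_mass (phi := phi) (u := u) m t) EE.
have -> : 2 * m' * l ^+ m = l ^+ m * m' + l ^+ m * m' by ring.
rewrite lerD//.
  rewrite ler_wpM2l ?exprn_ge0 ?(ltW l0)//; apply: le_trans mm.
  exact: (L1_clamp hKG hphi hu CM0).
have -> : m.*2.+1 = (m.+1 + m)%N by rewrite addSn addnn.
rewrite exprD mulrCA mulrA mulrA -mulrA le_eqVlt; apply/orP; left; apply/eqP.
have ln : l ^+ m.+1 != 0 by rewrite gt_eqF// exprn_gt0.
by set P := l ^+ m.+1 in ln *; set Q := l ^+ m; field.
Qed.

(** The barrier is [m' l^(q-1)] with [l = l0 m' / sqrt (T0 + t)] and [q = 2 m + 2].
The last four conditions say, in this order: [m'] exceeds the L^1 norm; the barrier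
starts above the initial power mass; [l] stays in the range where Nash's
inequality has a scale [k >= 1] to offer; and at a contact the dissipation
is at least [q / (T0 + t)] times the mass, whereas the barrier falls only at half
the rate [(q - 1) / (T0 + t)]. *)
Lemma power_mass_decay (T0 l0 m' : R) (m : nat) :
  0 < T0 -> 0 < l0 -> m0 < m' -> M0 * Num.sqrt T0 <= l0 * m' ->
  l0 ^+ 2 <= 64 * A ^+ 2 * T0 ->
  m.*2.+2%:R * (512 * A ^+ 3) <= (1 - C * M0) / 2 * l0 ^+ 2 ->
  forall t, 0 <= t ->
    power_mass (phi := phi) (u := u) m t <=
    m' * (l0 * m') ^+ m.*2.+1 * inv_sqrt T0 t ^+ m.*2.+1.
Proof.
move=> T00 l00 mm Ml lA ql t t0.
have m00 : 0 <= m0 by exact: Rintegral_ge0.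
have m'0 : 0 < m' by exact: le_lt_trans mm.
have lm0 : 0 < l0 * m' by exact: mulr_gt0.
pose b s := m' * (l0 * m') ^+ m.*2.+1 * inv_sqrt T0 s ^+ m.*2.+1.
have c0 : 0 <= m' * (l0 * m') ^+ m.*2.+1 by rewrite mulr_ge0 ?exprn_ge0 ?ltW.
suff : power_mass (phi := phi) (u := u) m t - b t <= 0 by rewrite subr_le0.
apply: (@barrier _ (fun s => power_mass (phi := phi) (u := u) m s - b s) t);
  last by rewrite t0 lexx.
- apply: continuous_from0B; first exact: (power_mass_continuous hKG hphi hu CM0).
  exact: inv_sqrt_power_continuous.
- have E0 : power_mass (phi := phi) (u := u) m 0 <= M0 ^+ m.*2.+1 * m0.
    apply: le_trans (_ : M0 ^+ m.*2.+1 * \int[mu]_x `|clu 0 x| <= _); last first.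
      rewrite ler_wpM2l ?exprn_ge0 ?initial_bound_ge0//.
      exact: (L1_clamp hKG hphi hu CM0).
    rewrite -RintegralZl//; last exact/intg_norm/iclu.
    apply: le_Rintegral => //.
    + by apply: (@intg_pow _ _ M0) => //; exact: iclu.
    + exact/intgZl/intg_norm/iclu.
    + move=> x _; apply: le_trans (ler_norm _) _; rewrite normrX exprSr.
      by rewrite ler_wpM2r// lerXn2r// ?nnegrE// initial_bound_ge0.
  have s0 : 0 < inv_sqrt T0 0 by exact: inv_sqrt_gt0.
  have Ms : M0 <= l0 * m' * inv_sqrt T0 0.
    by rewrite /inv_sqrt addr0 ler_pdivlMr// sqrtr_gt0.
  rewrite subr_lt0 /b -mulrA -exprMn; apply: le_lt_trans E0 _.
  apply: le_lt_trans (_ : (l0 * m' * inv_sqrt T0 0) ^+ m.*2.+1 * m0 < _).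
    by rewrite ler_wpM2r// lerXn2r// ?nnegrE ?initial_bound_ge0// (le_trans _ Ms)// initial_bound_ge0.
  by rewrite mulrC ltr_pM2r// exprn_gt0// mulr_gt0.
move=> s s_gt0 st /eqP; rewrite subr_eq0 => /eqP es; have s0 := ltW s_gt0.
set E := power_mass m s in es.
have a0 : 0 < T0 + s by rewrite ltr_wpDr.
have sg0 : 0 < inv_sqrt T0 s by exact: inv_sqrt_gt0.
pose l := l0 * m' * inv_sqrt T0 s.
have lp : 0 < l by exact: mulr_gt0.
have El : E = m' * l ^+ m.*2.+1 by rewrite es /b -mulrA -exprMn.
have E0 : 0 < E by rewrite El mulr_gt0// exprn_gt0.
have l2 : l ^+ 2 = (l0 * m') ^+ 2 / (T0 + s) by rewrite /l (exprMn 2 (l0 * m')) inv_sqrt_sqr.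
have lle : l <= 8 * A * m'.
  rewrite -(@ler_pXn2r _ 2)// ?nnegrE ?(ltW lp) ?mulr_ge0 ?(ltW A0) ?(ltW m'0)//.
  rewrite l2 ler_pdivrMr// exprMn.
  have -> : (8 * A * m') ^+ 2 * (T0 + s) = 64 * A ^+ 2 * (T0 + s) * m' ^+ 2 by ring.
  rewrite ler_wpM2r ?sqr_ge0//; apply: le_trans lA _.
  have A2 : 0 <= 64 * A ^+ 2 by apply: mulr_ge0 => //; exact: sqr_ge0.
  by apply: ler_wpM2l => //; rewrite lerDl.
have diss := dissipation_lower_bound s0 lp (ltW mm) m'0 lle El.
set D := dirichlet _ in diss.
have kap0 : 0 < (1 - C * M0) / 2 by rewrite divr_gt0// subr_gt0.
have qD : m.*2.+2%:R * (E / (T0 + s)) <= (1 - C * M0) / 2 * D.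
  rewrite l2 in diss.
  have A3 : 0 < 512 * A ^+ 3 by rewrite mulr_gt0// exprn_gt0.
  have d1 : E / (T0 + s) * l0 ^+ 2 <= 512 * A ^+ 3 * D.
    rewrite -(ler_pM2r (exprn_gt0 2 m'0)).
    apply: le_trans (_ : E * ((l0 * m') ^+ 2 / (T0 + s)) <= _).
      by rewrite le_eqVlt; apply/orP; left; apply/eqP; field; rewrite gt_eqF.
    by apply: le_trans diss _; rewrite le_eqVlt; apply/orP; left; apply/eqP; ring.
  have Ea : 0 <= E / (T0 + s) by rewrite divr_ge0// ltW.
  rewrite -(ler_pM2r A3).
  apply: le_trans (_ : (1 - C * M0) / 2 * (E / (T0 + s) * l0 ^+ 2) <= _).
    have := ler_wpM2l Ea ql; rewrite [E / _ * (_ * _)]mulrA [E / _ * _%:R]mulrC.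
    by move=> /le_trans; apply; rewrite mulrCA.
  by rewrite -[leRHS]mulrA ler_wpM2l ?(ltW kap0)// [D * _]mulrC.
have e0 : 0 < E / (T0 + s) by rewrite divr_gt0.
have [r r0 rP] := power_mass_step hKG hphi hu CM0 m s_gt0 e0.
exists (Num.min r (T0 + s)); first by rewrite lt_min r0.
move=> h h0; rewrite lt_min => /andP[hr ha]; rewrite subr_le0.
apply: (barrier_step h0 (rP h h0 hr) qD (lexx _) (_ : _ = m.*2.+1%:R + 1) _).
  by rewrite -[m.*2.+2]addn1 natrD.
rewrite -/E es /b -mulrA ler_wpM2l//.
by apply: inv_sqrt_power_ge => //; exact: ltW.
Qed.

End power_mass_decay.

(** * Decay of the Lp norms *)

Section lp_decay.
Context {R : realType} {K G : R -> R} {C : R}.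
Hypothesis hKG : admissible_kernels K G C.
Local Notation mu := (@lebesgue_measure R).
Local Notation intg f := (mu.-integrable setT (EFin \o f)).

(** The constants are chosen before the initial datum: [l0] large enough for the
dissipation, then [T0] for the range of scales, then [m'] for the initial
condition. *)
Lemma power_mass_decay_uniform (m : nat) (m1 M1 : R) : 0 <= m1 -> 0 <= M1 -> C * M1 < 1 ->
  exists B : R, forall (phi : R -> R) (u : R -> R -> R),
    in_L1Loo phi -> global_solution K G phi u ->
    \int[mu]_x `|phi x| = m1 -> fine (LpNorm +oo phi) = M1 ->
    forall t : R, 0 < t ->
      power_mass (phi := phi) (u := u) m t <= B * (t `^ (- (1 / 2))) ^+ m.*2.+1.
Proof.
move=> m10 M10 CM1; have [A A0 nash] := nash_inequality hKG.
have kap0 : 0 < (1 - C * M1) / 2 by rewrite divr_gt0// subr_gt0.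
pose Q : R := m.*2.+2%:R * (512 * A ^+ 3) / ((1 - C * M1) / 2).
have Q0 : 0 <= Q.
  have A30 : 0 <= A ^+ 3 by exact/exprn_ge0/ltW.
  by apply: divr_ge0; [apply: mulr_ge0 => //; exact: mulr_ge0|exact: ltW].
pose l0 := 1 + Q.
have l00 : 0 < l0 by rewrite ltr_wpDr.
pose T0 : R := 1 + l0 ^+ 2 / (64 * A ^+ 2).
have A20 : 0 < 64 * A ^+ 2 by rewrite mulr_gt0// exprn_gt0.
have T00 : 0 < T0 by rewrite ltr_wpDr// divr_ge0 ?sqr_ge0// ltW.
pose m' := m1 + 1 + M1 * Num.sqrt T0 / l0.
have Ms0 : 0 <= M1 * Num.sqrt T0 / l0.
  by apply: divr_ge0; [rewrite mulr_ge0// sqrtr_ge0|exact: ltW].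
exists (m' * (l0 * m') ^+ m.*2.+1) => phi u hphi hu e1 e2 t t0.
have h1 : \int[mu]_x `|phi x| < m' by rewrite e1 /m'; lra.
have h2 : fine (LpNorm +oo phi) * Num.sqrt T0 <= l0 * m'.
  by rewrite e2 [leRHS]mulrC -ler_pdivrMr// /m'; lra.
have h3 : l0 ^+ 2 <= 64 * A ^+ 2 * T0.
  have -> : 64 * A ^+ 2 * T0 = 64 * A ^+ 2 + l0 ^+ 2.
    by rewrite /T0; field; rewrite gt_eqF.
  by rewrite lerDr ltW.
have h4 : m.*2.+2%:R * (512 * A ^+ 3) <= (1 - C * fine (LpNorm +oo phi)) / 2 * l0 ^+ 2.
  rewrite e2 [leRHS]mulrC -ler_pdivrMr// -/Q /l0.
  by have := sqr_ge0 Q; rewrite sqrrD; lra.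
have CM : C * fine (LpNorm +oo phi) < 1 by rewrite e2.
have := power_mass_decay hKG hphi hu CM A0 nash T00 l00 h1 h2 h3 h4 (ltW t0).
move=> /le_trans; apply; rewrite ler_wpM2l//.
  have m'0 : 0 <= m' by rewrite addr_ge0// addr_ge0.
  by rewrite mulr_ge0// exprn_ge0// mulr_ge0// ltW.
rewrite lerXn2r ?nnegrE ?powR_ge0//; first exact/ltW/inv_sqrt_gt0/ltW.
rewrite powRN div1r powR12_sqrt ?(ltW t0)// lef_pV2 ?posrE ?sqrtr_gt0//; last first.
  by rewrite addr_gt0.
by rewrite ler_wsqrtr// lerDr ltW.
Qed.

Lemma LpNorm_interpolation (f : R -> R) (p l N1 Nq : R) (m : nat) :
  1 <= p <= m.*2.+2%:R -> 0 < l -> intg f -> intg (fun x => f x ^+ m.*2.+2) ->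
  \int[mu]_x `|f x| <= N1 -> \int[mu]_x (f x ^+ m.*2.+2) <= Nq ->
  (LpNorm p%:E f <= ((l `^ (p - 1) * N1 + l `^ (p - m.*2.+2%:R) * Nq) `^ p^-1)%:E)%E.
Proof.
move=> pq l0 fi fqi f1 fq; have /andP[p1 _] := pq.
have p0 : 0 < p by exact: lt_le_trans p1.
have mf := intg_measurable fi.
have ev x : `|f x| ^+ m.*2.+2 = f x ^+ m.*2.+2.
  by rewrite -normrX ger0_norm// -doubleS -muln2 exprM sqr_ge0.
have ig : intg (fun x => l `^ (p - 1) * `|f x| + l `^ (p - m.*2.+2%:R) * f x ^+ m.*2.+2).
  by apply: intgD; apply: intgZl => //; exact: intg_norm.
have g0 x : 0 <= l `^ (p - 1) * `|f x| + l `^ (p - m.*2.+2%:R) * f x ^+ m.*2.+2.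
  by rewrite -ev addr_ge0// mulr_ge0 ?powR_ge0// exprn_ge0.
have bound : (\int[mu]_x (`|f x| `^ p)%:E <=
    (l `^ (p - 1) * N1 + l `^ (p - m.*2.+2%:R) * Nq)%:E)%E.
  apply: (@le_trans _ _ (\int[mu]_x (l `^ (p - 1) * `|f x| +
      l `^ (p - m.*2.+2%:R) * f x ^+ m.*2.+2)%:E)%E).
    apply: ge0_le_integral => //.
    - apply/measurable_EFinP; apply: (measurableT_comp (measurable_powR _)).
      exact: measurableT_comp.
    - exact: measurable_int ig.
    - by move=> x _; rewrite lee_fin -ev; exact: powR_interpolation.
  rewrite -intg_fineK// lee_fin RintegralD//; last 2 first.
  - exact/intgZl/intg_norm.
  - exact: intgZl.
  rewrite !RintegralZl//; last exact: intg_norm.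
  by apply: lerD; rewrite ler_wpM2l// powR_ge0.
rewrite /LpNorm unlock.
pose I := (\int[mu]_x (`|f x| `^ p)%:E)%E.
have -> : (\int[mu]_x `|(EFin \o f) x| `^ p = I)%E by apply: eq_integral.
have I0 : (0 <= I)%E by apply: integral_ge0 => x _; rewrite lee_fin powR_ge0.
have {bound} : (I <= (l `^ (p - 1) * N1 + l `^ (p - m.*2.+2%:R) * Nq)%:E)%E by [].
case: (I) I0 => [r||]//; rewrite !lee_fin => r0 rb.
apply: ge0_ler_powR; rewrite ?nnegrE ?invr_ge0 ?(ltW p0)//.
exact: le_trans rb.
Qed.

Lemma LpNorm_decay (p : R) : 1 <= p ->
  exists c : R -> R -> R, forall (phi : R -> R) (u : R -> R -> R),
    in_L1Loo phi -> (LpNorm +oo phi < (1 / C)%:E)%E -> global_solution K G phi u ->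
    forall t : R, 0 < t ->
      (LpNorm p%:E (u t) <=
        (c (fine (LpNorm 1 phi)) (fine (LpNorm +oo phi)) *
         t `^ (- (1 / 2 * (1 - 1 / p))))%:E)%E.
Proof.
move=> p1; have p0 : 0 < p by exact: lt_le_trans p1.
pose m := Num.bound p.
have pm : p <= m.*2.+2%:R.
  apply: ltW; apply: lt_le_trans (archi_boundP (ltW p0)) _.
  by rewrite ler_nat -addnn -[_.+2]addn2 -addnA; exact: leq_addr.
(* outside the admissible range of the two norms the constant is arbitrary *)
have exB (z : R * R) : exists b : R, 0 <= z.1 -> 0 <= z.2 -> C * z.2 < 1 ->
    forall (phi : R -> R) (u : R -> R -> R),
    in_L1Loo phi -> global_solution K G phi u ->
    \int[mu]_x `|phi x| = z.1 -> fine (LpNorm +oo phi) = z.2 ->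
    forall t : R, 0 < t ->
      power_mass (phi := phi) (u := u) m t <= b * (t `^ (- (1 / 2))) ^+ m.*2.+1.
  move: z => [m1 M1] /=.
  have [m10|] := pselect (0 <= m1); last by exists 0.
  have [M10|] := pselect (0 <= M1); last by exists 0.
  have [CM1|] := pselect (C * M1 < 1); last by exists 0.
  by have [b bP] := power_mass_decay_uniform m m10 M10 CM1; exists b.
have [B BP] := choice exB.
exists (fun m1 M1 => (m1 + B (m1, M1)) `^ p^-1) => phi u hphi hC hu t t0.
have C0 := kernel_const_gt0 hKG.
have CM : C * fine (LpNorm +oo phi) < 1.
  by move: hC; rewrite (in_L1Loo_fin hphi) lte_fin ltr_pdivlMr// mulrC.
have M00 : 0 <= fine (LpNorm +oo phi) := initial_bound_ge0 hphi.
have e1 : fine (LpNorm 1 phi) = \int[mu]_x `|phi x|.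
  by rewrite LpNorm1E//; exact: in_L1Loo_intg.
have m00 : 0 <= \int[mu]_x `|phi x| by exact: Rintegral_ge0.
rewrite e1; set m0 := \int[mu]_x `|phi x| in m00 e1 *; set M0 := fine _ in CM M00 *.
have mass := BP (m0, M0) m00 M00 CM phi u hphi hu erefl erefl t t0.
have L1 := solution_L1 hKG hphi hu CM (ltW t0).
have uM := solution_maximum hKG hphi hu CM (ltW t0).
have iu := solution_intg hu (ltW t0).
have icl := clamp_intg M00 iu.
set l := t `^ (- (1 / 2)) in mass.
have l0 : 0 < l by exact: powR_gt0.
have icq : intg (fun x => clamp M0 (u t) x ^+ m.*2.+2).
  by apply: (@intg_pow _ _ M0) => // x; exact: clamp_bounded.
have clE : {ae mu, forall x, u t x = clamp M0 (u t) x}.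
  by apply: ae_imply uM => x xM; rewrite clamp_id.
have clL : LpNorm p%:E (u t) = LpNorm p%:E (clamp M0 (u t)).
  rewrite /LpNorm unlock; congr (_ `^ _)%E; apply: ae_eq_integral => //.
  - apply/measurable_EFinP; apply: (measurableT_comp (measurable_powR _)).
    by apply: measurableT_comp => //; exact: intg_measurable iu.
  - apply/measurable_EFinP; apply: (measurableT_comp (measurable_powR _)).
    by apply: measurableT_comp => //; exact: intg_measurable icl.
  - by apply: ae_imply clE => x /= -> _.
rewrite clL.
have pq : 1 <= p <= m.*2.+2%:R by rewrite p1.
apply: le_trans (LpNorm_interpolation pq l0 icl icq (L1_clamp hKG hphi hu CM (ltW t0)) mass) _.
rewrite lee_fin.
have -> : l `^ (p - 1) * m0 + l `^ (p - m.*2.+2%:R) * (B (m0, M0) * l ^+ m.*2.+1) =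
          (m0 + B (m0, M0)) * l `^ (p - 1).
  have e : l `^ (p - m.*2.+2%:R) * l ^+ m.*2.+1 = l `^ (p - 1).
    rewrite -powR_mulrn ?(ltW l0)// -powRD; last by rewrite (gt_eqF l0) implybT.
    by congr (_ `^ _); rewrite -[m.*2.+2]addn1 natrD; ring.
  by rewrite mulrCA e; ring.
have B0 : 0 <= m0 + B (m0, M0).
  have h : 0 <= B (m0, M0) * l ^+ m.*2.+1.
    apply: le_trans mass; apply: Rintegral_ge0 => x _.
    by rewrite -doubleS -muln2 exprM sqr_ge0.
  by rewrite addr_ge0//; move: h; rewrite pmulr_lge0// exprn_gt0.
rewrite powRM ?powR_ge0// /l -!powRrM.
rewrite le_eqVlt; apply/orP; left; apply/eqP; congr (_ * _ `^ _).
by field; rewrite gt_eqF.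
Qed.

End lp_decay.

(** * Decay of the solution in time *)

Unset Implicit Arguments.

Theorem theorem1p2 (R : realType) (K G : R -> R) (CGK : R)
  (hKG : admissible_kernels K G CGK)
  (hK2 : (\int[lebesgue_measure]_x (`|K x| * (1 + x ^+ 2))%:E < +oo)%E) :
  (exists C : R -> R -> R,
     forall (phi : R -> R) (u : R -> R -> R),
       in_L1Loo phi ->
       (LpNorm +oo phi < (1 / CGK)%:E)%E ->
       global_solution K G phi u ->
       forall t : R, 0 < t ->
         (LpNorm 2%:E (u t) <=
          (C (fine (LpNorm 1 phi)) (fine (LpNorm +oo phi)) *
           t `^ (- (1 / 4)))%:E)%E)
  /\
  (forall p : R, 2 <= p ->
   exists C : R -> R -> R,
     forall (phi : R -> R) (u : R -> R -> R),
       in_L1Loo phi ->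
       (LpNorm +oo phi < (1 / (2 * CGK))%:E)%E ->
       global_solution K G phi u ->
       forall t : R, 0 < t ->
         (LpNorm p%:E (u t) <=
          (C (fine (LpNorm 1 phi)) (fine (LpNorm +oo phi)) *
           t `^ (- (1 / 2 * (1 - 1 / p))))%:E)%E).
Proof.
split.
  have [C CP] := LpNorm_decay hKG (ler1n R 2).
  exists C => phi u hphi hC hu t t0.
  have -> : - (1 / 4) = - (1 / 2 * (1 - 1 / 2)) :> R by field.
  exact: CP.
move=> p p2; have p1 : 1 <= p by apply: le_trans p2; rewrite ler1n.
have [C CP] := LpNorm_decay hKG p1.
exists C => phi u hphi hC hu; apply: CP => //; apply: (lt_le_trans hC).
have C0 := kernel_const_gt0 hKG.
rewrite lee_fin ler_pM2l// lef_pV2 ?posrE ?mulr_gt0//.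
by rewrite ler_peMl ?(ltW C0)// ler1n.
Qed.
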